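(* Let $k$ be an algebraically closed field of characteristic $p>0$, let $\mathcal{E}$ be an elementary abelian group scheme over $k$, and let $j\in\{1,\ldots,p-1\}$. If $M$ is a finite-dimensional $\mathcal{E}$-module of constant $j$-rank, with dual $\mathcal{E}$-module $M^\ast$, then \[ \deg^j(M)+\deg^j(M^\ast)=j\,\mathrm{rk}^j(M).\]
   Context: $k\mathcal{E}=k[\mathcal{E}]^\ast$ is the algebra of measures of $\mathcal{E}$; $\mathcal{E}$-modules are $k\mathcal{E}$-modules; $M^\ast$ is formed via the antipode of the Hopf algebra $k\mathcal{E}$; for $u\in k\mathcal{E}$, $u_M$ is the operator $m\mapsto um$ on $M$. An abelian finite group scheme $\mathcal{E}$ is elementary abelian if it is a product $\mathcal{E}=\mathcal{E}_1\cdots\mathcal{E}_n$ of subgroups, each isomorphic to a Frobenius kernel $\mathbb{G}_{a(r_i)}$ of the additive group or to the constant group $\mathbb{Z}/(p)$. Then $k\mathcal{E}$ is isomorphic, as an algebra, to a truncated polynomial ring $k[X_1,\ldots,X_s]/(X_1^p,\ldots,X_s^p)$. Let $\mathfrak{A}_p=k[T]/(T^p)$, $t=T+(T^p)$. A $p$-point of $\mathcal{E}$ is an algebra homomorphism $\alpha:\mathfrak{A}_p\to k\mathcal{E}$ making $k\mathcal{E}$ a projective $\mathfrak{A}_p$-module; via $\alpha\mapsto\alpha(t)$, the $p$-points correspond to the elements of $\mathrm{Rad}(k\mathcal{E})\setminus\mathrm{Rad}^2(k\mathcal{E})$. $\mathrm{rk}^j(M)$ is the maximum of $\mathrm{rk}(\alpha(t)_M^j)$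 over all $p$-points, and $M$ has constant $j$-rank if $\mathrm{rk}(\alpha(t)_M^j)=\mathrm{rk}^j(M)$ for all $p$-points $\alpha$. Degree of a morphism: if $U\subseteq\mathbb{P}^n$ is non-empty open and $\varphi:U\to\mathbb{P}^m$ is a morphism, there are homogeneous polynomials $f_0,\ldots,f_m\in k[X_0,\ldots,X_n]$ of the same degree $d$ with $\gcd(f_0,\ldots,f_m)=1$ and $\varphi(x)=(f_0(x):\cdots:f_m(x))$ for all $x\in U$; they are unique up to a common non-zero scalar, and $\deg(\varphi):=d$. Degree of a module $M$ of constant $j$-rank $d$: let $U_{\mathcal{E}}=\{[u]\in\mathbb{P}(\mathrm{Rad}(k\mathcal{E})) : u\notin\mathrm{Rad}^2(k\mathcal{E})\}$, a dense open subset of the projective space $\mathbb{P}(\mathrm{Rad}(k\mathcal{E}))$, and let $\mathrm{Im}^j_M:U_{\mathcal{E}}\to\mathrm{Gr}_d(M)$, $[u]\mapsto\mathrm{im}(u_M^j)$, a morphism to the Grassmannian of $d$-dimensional subspaces. Then $\deg^j(M):=\deg(\mathrm{pl}_M\circ\mathrm{Im}^j_M)$, where $\mathrm{pl}_M:\mathrm{Gr}_d(M)\to\mathbb{P}(\bigwedge^d M)$ is the Plücker embedding ($\deg^j(M)=0$ if $d=0$).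
   Formalization: The case where the algebra of measures is k[X]/(X^p) (s = 1) is excluded: there the image of u_M^j is the same for all u, so both degrees are 0, and the identity fails e.g. for E = Z/(p), M = kE, where j rk^j(M) = j(p-j) > 0. *)

(* Defs.v *)
From HB Require Import structures.
From mathcomp Require Import all_boot all_order all_algebra all_field.
From mathcomp Require Import boolp classical_sets.
From mathcomp Require Import mpoly.

Set Implicit Arguments.
Unset Strict Implicit.
Unset Printing Implicit Defensive.

Import GRing.Theory VectorInternalTheory.
Local Open Scope ring_scope.

Lemma linfunE (K : fieldType) (V W : vectType K) (f : V -> W) :
  linear f -> linfun f =1 f.
Proof.
move=> lf.
pose F : {linear V -> W} := HB.pack f (GRing.isLinear.Build K V W _ f lf).
by move=> x; rewrite (lfunE F).
Qed.

Section Tensor.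
Variable k : fieldType.
Implicit Types U V W X : vectType k.

(* The tensor product of finite-dimensional spaces, in coordinates with
   respect to the bases given by [v2r]. *)
Definition tens U V : vectType k := 'M[k]_(dim U, dim V).

Definition tpure U V (u : U) (v : V) : tens U V := (v2r u)^T *m v2r v.

(* The linear map on [tens U V] induced by a bilinear map. *)
Definition tlift U V W (B : U -> V -> W) (t : tens U V) : W :=
  \sum_i \sum_j
    (t : 'M_(_, _)) i j *: B (r2v (delta_mx 0 i)) (r2v (delta_mx 0 j)).

Definition bilin U V W (B : U -> V -> W) : Prop :=
  (forall u, linear (B u)) /\ (forall v, linear (B^~ v)).

End Tensor.

Local Notation "u \ox v" := (tpure u v) (at level 40, left associativity).

Section TensorTheory.
Variable k : fieldType.
Implicit Types U V W X : vectType k.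

Lemma linD (V W : vectType k) (f : V -> W) x y :
  linear f -> f (x + y) = f x + f y.
Proof. by move=> lf; have := lf 1 x y; rewrite !scale1r. Qed.

Lemma lin0 (V W : vectType k) (f : V -> W) : linear f -> f 0 = 0.
Proof. by move=> lf; apply: (addrI (f 0)); rewrite -linD // !addr0. Qed.

Lemma linZ (V W : vectType k) (f : V -> W) a x :
  linear f -> f (a *: x) = a *: f x.
Proof. by move=> lf; have := lf a x 0; rewrite !addr0 lin0 // addr0. Qed.

Lemma lin_sum (V W : vectType k) (f : V -> W) I (r : seq I) P (F : I -> V) :
  linear f -> f (\sum_(i <- r | P i) F i) = \sum_(i <- r | P i) f (F i).
Proof.
move=> lf; elim: r => [|i r IH]; first by rewrite !big_nil lin0.
by rewrite !big_cons; case: ifP => // _; rewrite linD // IH.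
Qed.

Lemma tpure_bilin U V : bilin (@tpure k U V).
Proof.
by split=> [u|v] a x y; rewrite /tpure !linearP /= ?mulmxDl ?mulmxDr
  -?scalemxAl -?scalemxAr.
Qed.

Lemma tlift_linear U V W (B : U -> V -> W) : linear (tlift B).
Proof.
move=> a s t; rewrite /tlift scaler_sumr -big_split; apply: eq_bigr => i _ /=.
rewrite scaler_sumr -big_split; apply: eq_bigr => j _ /=.
by rewrite !mxE scalerDl scalerA.
Qed.

Lemma vec_expand V (v : V) :
  v = \sum_i (v2r v) 0 i *: r2v (delta_mx 0 i).
Proof.
rewrite -[LHS]v2rK [in LHS](row_sum_delta (v2r v)) linear_sum /=.
by apply: eq_bigr => i _; rewrite linearZ.
Qed.

Lemma tlift_tpure U V W (B : U -> V -> W) u v :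
  bilin B -> tlift B (u \ox v) = B u v.
Proof.
move=> [Bl Br]; rewrite [in RHS](vec_expand u) (lin_sum _ _ _ (Br v)).
apply: eq_bigr => i _; rewrite (linZ _ _ (Br v)) [in RHS](vec_expand v).
rewrite (lin_sum _ _ _ (Bl _)) scaler_sumr; apply: eq_bigr => j _.
by rewrite (linZ _ _ (Bl _)) scalerA /tpure !mxE big_ord1 !mxE.
Qed.

Lemma tens_expand U V (t : tens U V) : t = tlift (@tpure k U V) t.
Proof.
apply/matrixP=> i j; rewrite [in LHS](matrix_sum_delta (t : 'M_(_, _))).
rewrite /tlift !summxE; apply: eq_bigr => a _.
rewrite !summxE; apply: eq_bigr => b _.
rewrite [in LHS]mxE [in RHS]mxE; congr (_ * _).
by rewrite /tpure !r2vK !mxE big_ord1 !mxE !eqxx /= -natrM mulnb.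
Qed.

Lemma tlift_comp U V W X (B : U -> V -> W) (f : W -> X) t :
  linear f -> f (tlift B t) = tlift (fun u v => f (B u v)) t.
Proof.
move=> lf; rewrite /tlift lin_sum //; apply: eq_bigr => i _.
by rewrite lin_sum //; apply: eq_bigr => j _; rewrite linZ.
Qed.

Lemma eq_tlift U V W (B C : U -> V -> W) t :
  (forall u v, B u v = C u v) -> tlift B t = tlift C t.
Proof.
by move=> eqBC; apply: eq_bigr => i _; apply: eq_bigr => j _; rewrite eqBC.
Qed.

Lemma tens_ind U V W (f g : tens U V -> W) :
  linear f -> linear g -> (forall u v, f (u \ox v) = g (u \ox v)) -> f =1 g.
Proof.
move=> lf lg fg t; rewrite (tens_expand t) !tlift_comp //.
exact: eq_tlift.
Qed.

Lemma tlift_param_linear U V W X (B : X -> U -> V -> W) t :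
  (forall u v, linear (fun x => B x u v)) -> linear (fun x => tlift (B x) t).
Proof.
move=> lB a x y; rewrite /tlift scaler_sumr -big_split.
apply: eq_bigr => i _ /=; rewrite scaler_sumr -big_split.
apply: eq_bigr => j _ /=; rewrite lB scalerDr.
by congr (_ + _); rewrite !scalerA mulrC.
Qed.

Lemma comp_linear U V W (f : V -> W) (g : U -> V) :
  linear f -> linear g -> linear (fun x => f (g x)).
Proof. by move=> lf lg a x y; rewrite lg lf. Qed.

Lemma bilin_comp U V W (U' V' : vectType k) (B : U -> V -> W) (f : U' -> U) (g : V' -> V) :
  bilin B -> linear f -> linear g -> bilin (fun x y => B (f x) (g y)).
Proof.
move=> [Bl Br] lf lg; split=> [u|v]; first exact: comp_linear.
exact: (comp_linear (Br _)).
Qed.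

Lemma hom_linear V W (f : 'Hom(V, W)) : linear f.
Proof. exact: linearP. Qed.

Lemma id_linear V : linear (fun x : V => x).
Proof. by []. Qed.

End TensorTheory.

Lemma mul_bilin (k : fieldType) (A : falgType k) :
  bilin (fun a b : A => a * b).
Proof.
by split=> [u|v] a x y; rewrite ?mulrDr ?mulrDl -?scalerAr -?scalerAl.
Qed.

Section Hopf.
Variable k : fieldType.

(* In Sweedler notation, [tlift B (comul x)] is \sum B x_(1) x_(2). *)
Record hopfAlgebra := HopfAlgebra {
  hopf_alg :> falgType k;
  comul : 'Hom(hopf_alg, tens hopf_alg hopf_alg);
  counit : 'Hom(hopf_alg, k^o);
  antipode : 'Hom(hopf_alg, hopf_alg);
  comul1 : comul 1 = 1 \ox 1;
  comulM : forall x y : hopf_alg, comul (x * y) =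
    tlift (fun a b => tlift (fun c d => (a * c) \ox (b * d)) (comul y))
          (comul x);
  counit1 : counit 1 = 1;
  counitM : forall x y, counit (x * y) = counit x * counit y;
  comulA : forall x,
    tlift (fun a b => a \ox comul b) (comul x) =
    tlift (fun a b => tlift (fun c d => c \ox (d \ox b)) (comul a)) (comul x);
  counitl : forall x, tlift (fun a b => counit a *: b) (comul x) = x;
  counitr : forall x, tlift (fun a b => counit b *: a) (comul x) = x;
  antipodel : forall x,
    tlift (fun a b => antipode a * b) (comul x) = (counit x)%:A;
  antipoder : forall x,
    tlift (fun a b => a * antipode b) (comul x) = (counit x)%:A
}.

Arguments comul {h}.
Arguments counit {h}.
Arguments antipode {h}.

Record hopf_morphism (A B : hopfAlgebra) (f : 'Hom(A, B)) : Prop := {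
  hopf_mor1 : f 1 = 1;
  hopf_morM : forall x y, f (x * y) = f x * f y;
  hopf_mor_comul : forall x,
    comul (f x) = tlift (fun a b => f a \ox f b) (comul x);
  hopf_mor_counit : forall x, counit (f x) = counit x
}.

(* A finite group scheme is given by its coordinate ring k[E]. *)
Record finGroupScheme := FinGroupScheme {
  coord_ring :> hopfAlgebra;
  coord_ringC : forall x y : coord_ring, x * y = y * x
}.

Definition abelian_scheme (E : finGroupScheme) : Prop :=
  forall x : E, tlift (fun a b => b \ox a) (comul x) = comul x.

End Hopf.

Arguments comul {k h}.
Arguments counit {k h}.
Arguments antipode {k h}.

Section HopfTheory.
Variables (k : fieldType) (A : hopfAlgebra k).
Implicit Types (x y : A) (V W : vectType k).

Lemma comul_linear : linear (@comul k A). Proof. exact: linearP. Qed.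

Lemma sweedler_linear W (B : A -> A -> W) :
  linear (fun x => tlift B (comul x)).
Proof. exact: (comp_linear (tlift_linear B) comul_linear). Qed.

Lemma coassoc W (T : A -> A -> A -> W) x :
  (forall b c, linear (fun a => T a b c)) ->
  (forall a c, linear (fun b => T a b c)) ->
  (forall a b, linear (T a b)) ->
  tlift (fun a b => tlift (T a) (comul b)) (comul x) =
  tlift (fun a b => tlift (fun c d => T c d b) (comul a)) (comul x).
Proof.
move=> l1 l2 l3.
have bT a : bilin (T a) by split=> [b|c]; [exact: l3|exact: l2].
pose L (t : tens A (tens A A)) : W := tlift (fun a s => tlift (T a) s) t.
have bL : bilin (fun a s => tlift (T a) s).
  split=> [a|s]; first exact: tlift_linear.
  exact: (tlift_param_linear (B := T)).
have lL : linear L := tlift_linear _.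
have := congr1 L (comulA x).
rewrite (tlift_comp _ _ lL) (tlift_comp _ _ lL).
rewrite (eq_tlift (C := fun a b => tlift (T a) (comul b))); last first.
  by move=> a b; rewrite /L tlift_tpure.
move=> ->; apply: eq_tlift => a b; rewrite (tlift_comp _ _ lL).
by apply: eq_tlift => c d; rewrite /L !tlift_tpure.
Qed.

End HopfTheory.

Section AntipodeComul.
Variables (k : fieldType) (A : hopfAlgebra k).
Local Notation T := (tens A A).
Local Notation S := (@antipode k A).

Let tmul (s t : T) : T :=
  tlift (fun a b => tlift (fun c d => (a * c) \ox (b * d)) t) s.

Let inner_bilin (a b : A) : bilin (fun c d : A => (a * c) \ox (b * d)).
Proof.
apply: (bilin_comp (@tpure_bilin k A A)); exact: (mul_bilin A).1.
Qed.

Let outer_bilin (t : T) :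
  bilin (fun a b => tlift (fun c d : A => (a * c) \ox (b * d)) t).
Proof.
split=> [a|b]; apply: tlift_param_linear => c d.
  by apply: (comp_linear ((@tpure_bilin k A A).1 _)); exact: (mul_bilin A).2.
apply: (comp_linear (f := fun s : A => s \ox (b * d))).
  exact: (@tpure_bilin k A A).2.
exact: (mul_bilin A).2.
Qed.

Let tmul_bilin : bilin tmul.
Proof.
split=> [s|t]; last exact: tlift_linear.
by apply: tlift_param_linear => a b; exact: tlift_linear.
Qed.

Let tmul_pure a b c d : tmul (a \ox b) (c \ox d) = (a * c) \ox (b * d).
Proof. by rewrite /tmul tlift_tpure // tlift_tpure. Qed.

Let tmulA s t r : tmul s (tmul t r) = tmul (tmul s t) r.
Proof.
have [L R] := tmul_bilin.
move: s; apply: tens_ind => [||a b].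
- exact: R.
- by apply: (comp_linear (R r)); exact: R.
move: t; apply: tens_ind => [||c d].
- by apply: (comp_linear (L _)); exact: R.
- by apply: (comp_linear (R r)); exact: L.
move: r; apply: tens_ind => [||e f].
- by apply: (comp_linear (L _)); exact: L.
- exact: L.
by rewrite !tmul_pure !mulrA.
Qed.

Let tmul1s s : tmul (1 \ox 1) s = s.
Proof.
move: s; apply: tens_ind => [||a b]; first exact: tmul_bilin.1.
  exact: id_linear.
by rewrite tmul_pure !mul1r.
Qed.

Let tmuls1 s : tmul s (1 \ox 1) = s.
Proof.
move: s; apply: tens_ind => [||a b]; first exact: tmul_bilin.2.
  exact: id_linear.
by rewrite tmul_pure !mulr1.
Qed.

Let conv (F G : A -> T) (x : A) : T := tlift (fun a b => tmul (F a) (G b)) (comul x).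
Let e (x : A) : T := counit x *: ((1 : A) \ox (1 : A)).

Let convA F G H x : linear F -> linear G -> linear H ->
  conv F (conv G H) x = conv (conv F G) H x.
Proof.
have [L R] := tmul_bilin; move=> lF lG lH.
pose M a b c := tmul (F a) (tmul (G b) (H c)).
transitivity (tlift (fun a b => tlift (M a) (comul b)) (comul x)).
  by apply: eq_tlift => a b; rewrite /conv (tlift_comp _ _ (L (F a))).
rewrite coassoc; first last.
- by move=> a b; apply: (comp_linear (L _)); apply: (comp_linear (L _)).
- move=> a c; apply: (comp_linear (L _)).
  exact: (comp_linear (R (H c))).
- by move=> b c; apply: (comp_linear (R _)).
apply: eq_tlift => a b.
rewrite /conv (tlift_comp _ _ (R (H b))).
by apply: eq_tlift => c d; rewrite /M tmulA.
Qed.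

Let eq_conv F F' G G' x : F =1 F' -> G =1 G' -> conv F G x = conv F' G' x.
Proof. by move=> eF eG; apply: eq_tlift => a b; rewrite eF eG. Qed.

Let conv1F F x : linear F -> conv e F x = F x.
Proof.
move=> lF; rewrite -[in RHS](counitl x) (tlift_comp _ _ lF).
apply: eq_tlift => a b.
by rewrite (linZ _ _ lF) /e (linZ _ _ (tmul_bilin.2 _)) tmul1s.
Qed.

Let convF1 F x : linear F -> conv F e x = F x.
Proof.
move=> lF; rewrite -[in RHS](counitr x) (tlift_comp _ _ lF).
apply: eq_tlift => a b.
by rewrite (linZ _ _ lF) /e (linZ _ _ (tmul_bilin.1 _)) tmuls1.
Qed.

Let SS (x : A) : T := tlift (fun a b => S b \ox S a) (comul x).
Let DS (x : A) : T := comul (S x).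

Let DS_linear : linear DS.
Proof. by apply: comp_linear; exact: hom_linear. Qed.

Let SS_linear : linear SS.
Proof. exact: sweedler_linear. Qed.

Let conv_DS x : conv DS (@comul k A) x = e x.
Proof.
rewrite /e -comul1 -(linZ _ _ (@comul_linear k A)) -antipodel.
rewrite (tlift_comp _ _ (@comul_linear k A)).
by apply: eq_tlift => a b; rewrite /DS comulM.
Qed.

Let conv_SS x : conv (@comul k A) SS x = e x.
Proof.
have [tL tR] := @tpure_bilin k A A; have [mL mR] := mul_bilin A.
have [L R] := tmul_bilin.
have lS : linear S by exact: hom_linear.
pose Q a b c d : T := (a * S d) \ox (b * S c).
have Q1 b c d : linear (fun a => Q a b c d).
  by apply: (comp_linear (f := fun s : A => s \ox _)) (tR _) _; exact: mR.
have Q2 a c d : linear (fun b => Q a b c d).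
  by apply: (comp_linear (tL _)); exact: mR.
have Q3 a b d : linear (fun c => Q a b c d).
  by apply: (comp_linear (tL _)); apply: (comp_linear (mL _)).
have Q4 a b c : linear (fun d => Q a b c d).
  apply: (comp_linear (f := fun s : A => s \ox _)) (tR _) _.
  exact: (comp_linear (mL _)).
transitivity (tlift (fun f b => tlift (fun a1 a2 =>
    tlift (Q a1 a2) (comul b)) (comul f)) (comul x)).
  apply: eq_tlift => f b.
  rewrite [in LHS](tens_expand (comul f)) (tlift_comp _ _ (R _)).
  apply: eq_tlift => a1 a2; rewrite /SS (tlift_comp _ _ (L _)).
  by apply: eq_tlift => c d; rewrite tmul_pure.
rewrite -(coassoc (T := fun a1 a2 b => tlift (Q a1 a2) (comul b))); first last.
- by move=> a b; apply: sweedler_linear.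
- by move=> a c; apply: tlift_param_linear.
- by move=> b c; apply: tlift_param_linear.
transitivity (tlift (fun a c : A => (a * S c) \ox (1 : A)) (comul x)).
  apply: eq_tlift => a c.
  rewrite (coassoc (T := Q a)) //.
  transitivity (tlift (fun f d : A => counit f *: ((a * S d) \ox (1 : A)))
                      (comul c)).
    apply: eq_tlift => f d.
    by rewrite /Q -(tlift_comp _ _ (tL _)) antipoder (linZ _ _ (tL _)).
  have lh : linear (fun d : A => (a * S d) \ox (1 : A)).
    apply: (comp_linear (f := fun s : A => s \ox _)) (tR _) _.
    exact: (comp_linear (mL _)).
  rewrite -[in RHS](counitl c) (tlift_comp _ _ lh).
  by apply: eq_tlift => f d; rewrite -(linZ _ _ lh).
rewrite -(tlift_comp (f := fun s : A => s \ox _) _ _ (tR _)) antipoder.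
by rewrite (linZ (f := fun s : A => s \ox _) _ _ (tR _)).
Qed.

Lemma antipode_comul (x : A) :
  comul (S x) = tlift (fun a b => S b \ox S a) (comul x).
Proof.
rewrite -[LHS]/(DS x) -(convF1 x DS_linear).
rewrite -(eq_conv x (frefl DS) conv_SS) convA //; last exact: comul_linear.
by rewrite (eq_conv x conv_DS (frefl SS)) conv1F.
Qed.

End AntipodeComul.

(* kE = k[E]^* with the convolution product. *)
Definition measures (k : fieldType) (E : finGroupScheme k) := 'Hom(E, k^o).

Section Measures.
Variables (k : fieldType) (E : finGroupScheme k).

HB.instance Definition _ := Vector.copy (measures E) 'Hom(E, k^o).

Implicit Types u v w : measures E.

Definition meas_mul u v : measures E :=
  linfun (fun f : E => tlift (fun a b => u a * v b : k^o) (comul f)).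
Definition meas_one : measures E := @counit k E.

Lemma meas_mulE u v f :
  meas_mul u v f = tlift (fun a b => u a * v b : k^o) (comul f).
Proof. by rewrite linfunE //; exact: sweedler_linear. Qed.

Let kmul_bilin : bilin (fun a b : k^o => a * b : k^o).
Proof. exact: (mul_bilin (k^o : falgType k)). Qed.

Fact meas_mulA : associative meas_mul.
Proof.
have [L R] := kmul_bilin.
move=> u v w; apply/lfunP => f; rewrite !meas_mulE.
transitivity (tlift (fun a b => tlift (fun c d => u a * (v c * w d) : k^o)
  (comul b)) (comul f)).
  by apply: eq_tlift => a b; rewrite meas_mulE (tlift_comp _ _ (L (u a))).
rewrite (coassoc (T := fun a c d => u a * (v c * w d) : k^o)); first last.
- by move=> a b; apply: (comp_linear (L _)); apply: (comp_linear (L _));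
    exact: hom_linear.
- move=> a c; apply: (comp_linear (L _)).
  by apply: (comp_linear (R _)); exact: hom_linear.
- by move=> b c; apply: (comp_linear (R _)); exact: hom_linear.
apply: eq_tlift => a b; rewrite meas_mulE (tlift_comp _ _ (R (w b))).
by apply: eq_tlift => c d; rewrite mulrA.
Qed.

Fact meas_mul1 : left_id meas_one meas_mul.
Proof.
move=> u; apply/lfunP => f; rewrite meas_mulE -[in RHS](counitl f).
rewrite (tlift_comp _ _ (hom_linear u)).
by apply: eq_tlift => a b; rewrite (linZ _ _ (hom_linear u)).
Qed.

Fact meas_mulr1 : right_id meas_one meas_mul.
Proof.
move=> u; apply/lfunP => f; rewrite meas_mulE -[in RHS](counitr f).
rewrite (tlift_comp _ _ (hom_linear u)).
by apply: eq_tlift => a b; rewrite (linZ _ _ (hom_linear u)) mulrC.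
Qed.

Fact meas_mul_bilin : bilin meas_mul.
Proof.
have [L R] := kmul_bilin.
split=> [u|v] a x y; apply/lfunP => f;
  rewrite add_lfunE scale_lfunE !meas_mulE /tlift scaler_sumr -big_split;
  apply: eq_bigr => i _ /=; rewrite scaler_sumr -big_split;
  apply: eq_bigr => j _ /=; rewrite add_lfunE scale_lfunE.
  by rewrite L scalerDr !scalerA [a * _]mulrC.
by rewrite (R (v _)) scalerDr !scalerA [a * _]mulrC.
Qed.

Fact meas_mulDl : left_distributive meas_mul +%R.
Proof. by move=> u v w; rewrite (linD _ _ (meas_mul_bilin.2 w)). Qed.

Fact meas_mulDr : right_distributive meas_mul +%R.
Proof. by move=> u v w; rewrite (linD _ _ (meas_mul_bilin.1 u)). Qed.

Fact meas_one_neq0 : meas_one != 0.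
Proof.
apply/eqP => /lfunP /(_ 1); rewrite counit1 zero_lfunE => /eqP.
by rewrite oner_eq0.
Qed.

HB.instance Definition _ := GRing.Zmodule_isNzRing.Build (measures E)
  meas_mulA meas_mul1 meas_mulr1 meas_mulDl meas_mulDr meas_one_neq0.

Fact meas_scaleAl a u v : a *: (u * v) = (a *: u) * v.
Proof. exact: esym (linZ a u (meas_mul_bilin.2 v)). Qed.

HB.instance Definition _ :=
  GRing.Lmodule_isLalgebra.Build k (measures E) meas_scaleAl.

Fact meas_scaleAr a u v : a *: (u * v) = u * (a *: v).
Proof. exact: esym (linZ a v (meas_mul_bilin.1 u)). Qed.

HB.instance Definition _ :=
  GRing.Lalgebra_isAlgebra.Build k (measures E) meas_scaleAr.

HB.instance Definition _ := Algebra_isFalgebra.Build k (measures E).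

Definition meas_antipode (u : measures E) : measures E :=
  (u \o @antipode k E)%VF.

Lemma meas_antipode_linear : linear meas_antipode.
Proof. by move=> a u v; rewrite /meas_antipode comp_lfunDl comp_lfunZl. Qed.

Lemma meas_antipode1 : meas_antipode 1 = 1.
Proof.
apply/lfunP => f; rewrite comp_lfunE /=.
have lc := hom_linear (@counit k E).
have := congr1 (@counit k E) (antipodel f); rewrite (linZ _ _ lc) counit1.
rewrite [_ *: _]mulr1 => <-; rewrite (tlift_comp _ _ lc).
rewrite -[in LHS](counitr f) (tlift_comp _ _ (hom_linear _)).
rewrite (tlift_comp _ _ lc); apply: eq_tlift => a b.
by rewrite (linZ _ _ (hom_linear _)) (linZ _ _ lc) counitM mulrC.
Qed.

Lemma meas_antipodeM u v :
  meas_antipode (u * v) = meas_antipode v * meas_antipode u.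
Proof.
have [L R] := kmul_bilin.
apply/lfunP => f; rewrite comp_lfunE /= !meas_mulE antipode_comul.
rewrite (tlift_comp _ _ (tlift_linear _)); apply: eq_tlift => a b.
rewrite tlift_tpure ?comp_lfunE 1?mulrC // .
by apply: (bilin_comp kmul_bilin); exact: hom_linear.
Qed.

End Measures.

Section ElementaryAbelian.
Variables (k : fieldType) (p : nat).

Record subgroupScheme (E : finGroupScheme k) := SubgroupScheme {
  sub_scheme :> finGroupScheme k;
  restriction : 'Hom(E, sub_scheme);
  restriction_mor : hopf_morphism restriction;
  restriction_surj : limg restriction = fullv
}.

(* The image of the inclusion of kF in kE, transpose to restriction. *)
Definition sub_measures E (F : subgroupScheme E) : {vspace measures E} :=
  limg (linfun (fun u : measures F => (u \o restriction F)%VF : measures E)).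

(* k[F] is isomorphic to k[T]/(T^(p^r)), with T primitive: t is the image of
   the class of T. *)
Definition is_Ga_kernel (r : nat) (F : finGroupScheme k) : Prop :=
  exists t : F, [/\ comul t = t \ox 1 + 1 \ox t,
    t ^+ (p ^ r) = 0 &
    basis_of fullv [seq t ^+ i | i <- iota 0 (p ^ r)]].

(* k[F] is isomorphic to the algebra of functions Z/(p) -> k: e c is the image
   of the indicator function of c. *)
Definition is_const_Zp (F : finGroupScheme k) : Prop :=
  exists e : 'Z_p -> F, [/\ basis_of fullv [seq e c | c : 'Z_p],
    (forall a b, e a * e b = (a == b)%:R *: e a) &
    (forall c, comul (e c) = \sum_(a : 'Z_p) e a \ox e (c - a))].

(* The product E_1 ... E_n is the image of E_1 x ... x E_n under
   multiplication; its algebra of measures is kE_1 ... kE_n. *)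
Definition elementary_abelian (E : finGroupScheme k) : Prop :=
  abelian_scheme E /\
  exists (n : nat) (F : 'I_n -> subgroupScheme E),
    (forall i, (exists2 r, (0 < r)%N & is_Ga_kernel r (F i))
               \/ is_const_Zp (F i)) /\
    \big[@prodv k (measures E)/1%VS]_(i < n) sub_measures (F i) = fullv.

End ElementaryAbelian.

Section Radical.
Variables (k : fieldType).

Lemma bigcap_vspace_ex (V : vectType k) (P : {vspace V} -> Prop) :
  exists R : {vspace V}, forall x, x \in R <-> forall I, P I -> x \in I.
Proof.
pose Q n := `[< exists2 s : seq {vspace V}, forall I, I \in s -> P I &
                 \dim (\bigcap_(I <- s) I)%VS = n >].
have exQ : exists n, Q n.
  exists (\dim {:V}); apply/asboolP; exists [::] => //.
  by rewrite big_nil.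
case: (ex_minnP exQ) => n /asboolP[s sP sn] min_n.
exists (\bigcap_(I <- s) I)%VS => x; split=> [xs I PI|xP]; last first.
  elim: s sP {sn} => [|J s IH] sP; first by rewrite big_nil memvf.
  rewrite big_cons memv_cap; apply/andP; split.
    by apply/xP/sP; exact: mem_head.
  by apply: IH => I Is; apply: sP; rewrite inE Is orbT.
have /min_n : Q (\dim (I :&: \bigcap_(J <- s) J)%VS).
  apply/asboolP; exists (I :: s); last by rewrite big_cons.
  by move=> J; rewrite inE => /orP[/eqP->|Js]; [exact: PI|exact: sP].
rewrite -sn => le; have := eqEdim (I :&: \bigcap_(J <- s) J)%VS
  (\bigcap_(J <- s) J)%VS.
rewrite le capvSr /= => /eqP eqI; move: xs; rewrite -eqI memv_cap.
by case/andP.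
Qed.

Definition left_ideal (H : falgType k) (I : {vspace H}) : Prop :=
  forall a x, x \in I -> a * x \in I.

Definition maximal_left_ideal (H : falgType k) (I : {vspace H}) : Prop :=
  [/\ left_ideal I, I != fullv &
      forall J : {vspace H}, left_ideal J -> (I <= J)%VS ->
        J = I \/ J = fullv].

Definition Rad (H : falgType k) : {vspace H} :=
  projT1 (cid (bigcap_vspace_ex (@maximal_left_ideal H))).

Lemma RadP (H : falgType k) x :
  x \in Rad H <-> forall I, maximal_left_ideal I -> x \in I.
Proof. exact: projT2 (cid (bigcap_vspace_ex (@maximal_left_ideal H))) x. Qed.

End Radical.

Definition projective (A : nzRingType) (P : lmodType A) : Prop :=
  forall (N N' : lmodType A) (g : {linear N -> N'}) (h : {linear P -> N'}),
    (forall y, exists x, g x = y) ->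
    exists h' : {linear P -> N}, forall x, g (h' x) = h x.

(* An alias of H, so that the A-module structure can depend on alpha. *)
Definition restr (A H : nzRingType) (alpha : {rmorphism A -> H}) : Type := H.

Section Restriction.
Variables (A H : nzRingType) (alpha : {rmorphism A -> H}).
Local Notation restr := (restr alpha).

HB.instance Definition _ := GRing.Zmodule.copy restr H.

Definition restr_scale (a : A) (x : restr) : restr := alpha a * (x : H).

Fact restr_scaleA a b x : restr_scale a (restr_scale b x) = restr_scale (a * b) x.
Proof. by rewrite /restr_scale rmorphM mulrA. Qed.
Fact restr_scale1 : left_id 1 restr_scale.
Proof. by move=> x; rewrite /restr_scale rmorph1 mul1r. Qed.
Fact restr_scaleDr : right_distributive restr_scale +%R.
Proof. by move=> a x y; rewrite /restr_scale mulrDr. Qed.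
Fact restr_scaleDl x : {morph restr_scale^~ x : a b / a + b}.
Proof. by move=> a b; rewrite /restr_scale rmorphD mulrDl. Qed.

HB.instance Definition _ := GRing.Zmodule_isLmodule.Build A restr
  restr_scaleA restr_scale1 restr_scaleDr restr_scaleDl.

End Restriction.

Section PPoints.
Variables (k : fieldType) (p : nat) (E : finGroupScheme k).

Local Notation truncated := {poly %/ ('X^p : {poly k})}.
Definition trunc_t : truncated := 'qX.

Record pPoint := PPoint {
  ppt_mor :> {lrmorphism truncated -> measures E};
  ppt_proj : projective (restr ppt_mor)
}.

End PPoints.

Section Modules.
Variables (k : fieldType) (E : finGroupScheme k).

Record eModule := EModule {
  emod_space :> vectType k;
  op : 'Hom(measures E, 'End(emod_space));
  op1 : op 1 = \1%VF;
  opM : forall u v, op (u * v) = (op u \o op v)%VF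
}.

Section Dual.
Variable M : eModule.

Definition dual_op_fun (u : measures E) : 'End('Hom(M, k^o)) :=
  linfun (fun phi : 'Hom(M, k^o) => (phi \o op M (meas_antipode u))%VF).

Lemma dual_op_funE u phi :
  dual_op_fun u phi = (phi \o op M (meas_antipode u))%VF.
Proof. by rewrite linfunE // => a f g; rewrite comp_lfunDl comp_lfunZl. Qed.

Definition dual_op : 'Hom(measures E, 'End('Hom(M, k^o))) :=
  linfun dual_op_fun.

Lemma dual_opE u phi :
  dual_op u phi = (phi \o op M (meas_antipode u))%VF.
Proof.
rewrite linfunE ?dual_op_funE // => a v w; apply/lfunP => f.
rewrite add_lfunE scale_lfunE !dual_op_funE meas_antipode_linear linearP.
by rewrite comp_lfunDr comp_lfunZr.
Qed.

Fact dual_op1 : dual_op 1 = \1%VF.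
Proof.
apply/lfunP => phi; rewrite dual_opE meas_antipode1 op1 id_lfunE.
by rewrite comp_lfun1r.
Qed.

Fact dual_opM u v : dual_op (u * v) = (dual_op u \o dual_op v)%VF.
Proof.
apply/lfunP => phi; rewrite comp_lfunE /= !dual_opE meas_antipodeM opM.
by rewrite comp_lfunA.
Qed.

(* (u phi)(m) = phi (eta(u) m), where eta is the antipode of kE. *)
Definition dual_module : eModule := EModule dual_op1 dual_opM.

End Dual.

(* Not a ring power: 'End(M) is not a nonzero ring when M = 0. *)
Definition op_pow (M : eModule) (u : measures E) (j : nat) : 'End(M) :=
  iter j (comp_lfun (op M u)) \1%VF.

Section Rank.
Variables (p : nat) (M : eModule) (j : nat).

Definition ppt_rank (alpha : pPoint p E) : nat :=
  \dim (limg (op_pow M (alpha (trunc_t k p)) j)).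

(* The ranks are at most dim M, so this is the maximum over all p-points. *)
Definition max_rank : nat :=
  \max_(r < (\dim {:M}).+1 | `[< exists alpha, ppt_rank alpha = r >]) r.

Definition constant_rank : Prop :=
  forall alpha, ppt_rank alpha = max_rank.

End Rank.

End Modules.

Section Degree.
Variable k : fieldType.

Definition mpoly_coprime (n : nat) (I : finType) (f : I -> {mpoly k[n]}) :
    Prop :=
  forall g : {mpoly k[n]}, (forall i, exists q, f i = q * g) ->
    g \is a GRing.unit.

(* The points of the projective space P(V) are the lines of V.  Given a set U
   of points of P(V) and a map phi : U -> P(k^I), phi has degree e if it is
   given by coprime homogeneous polynomials of degree e in the coordinates
   with respect to a basis of V. *)
Definition has_degree (H : vectType k) (V : {vspace H}) (I : finType)
    (U : {vspace H} -> Prop)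
    (phi : {vspace H} -> {vspace {ffun I -> k^o}}) (e : nat) : Prop :=
  exists f : I -> {mpoly k[\dim V]}, [/\ forall i, f i \is e.-homog,
    mpoly_coprime f &
    forall L, U L -> phi L =
      <[ [ffun i => (f i).@[fun l => coord (vbasis V) l (vpick L)] : k^o] ]>%VS].

Definition degree (H : vectType k) (V : {vspace H}) (I : finType)
    (U : {vspace H} -> Prop)
    (phi : {vspace H} -> {vspace {ffun I -> k^o}}) : nat :=
  xget 0%N [set e | has_degree V U phi e].

(* The strictly increasing maps {0,...,d-1} -> {0,...,m-1}, which index the
   standard basis of the d-th exterior power of k^m. *)
Definition incr_map (d m : nat) : finType :=
  {h : {ffun 'I_d -> 'I_m} |
    [forall a : 'I_d, forall b : 'I_d, (a < b)%N ==> (h a < h b)%N]}.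

(* The coordinates of v_0 /\ ... /\ v_(d-1) with respect to the basis of the
   exterior power of M given by a basis of M. *)
Definition wedge (M : vectType k) (d : nat) (v : 'I_d -> M) :
    {ffun incr_map d (\dim {:M}) -> k^o} :=
  [ffun h : incr_map d (\dim {:M}) => \det (\matrix_(a < d, b < d)
    coord (vbasis {:M}) (val h b) (v a)) : k^o].

(* Only meaningful when W has dimension d; the line does not depend on the
   choice of a basis of W. *)
Definition pluecker (M : vectType k) (d : nat) (W : {vspace M}) :
    {vspace {ffun incr_map d (\dim {:M}) -> k^o}} :=
  <[wedge (fun a : 'I_d => (vbasis W)`_a)]>%VS.

End Degree.

Section ModuleDegree.
Variables (k : fieldType) (p : nat) (E : finGroupScheme k).

(* Im_map is well defined on lines: L = <[vpick L]>, and a scalar factor does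
   not change an image. *)
Definition U_E (L : {vspace measures E}) : Prop :=
  [/\ \dim L = 1%N, (L <= Rad (measures E))%VS &
      ~~ (L <= Rad (measures E) ^+ 2)%VS].

Definition Im_map (M : eModule E) (j : nat) (L : {vspace measures E}) :
    {vspace M} :=
  limg (op_pow M (vpick L) j).

Definition mod_degree (M : eModule E) (j : nat) : nat :=
  let d := max_rank p M j in
  if d == 0%N then 0%N
  else degree (Rad (measures E)) U_E (fun L => pluecker d (Im_map M j L)).

End ModuleDegree.

(* Main.v *)
(* Write A = op(u)^j as a matrix whose entries are forms of degree j in the
   coordinates of u in Rad(kE), rows being taken in a basis of M and columns in
   a basis of M^*.  Its d x d minors, d = rk^j(M), span a rank one matrix at
   every point of U_E, hence factor as N_IJ = a_I b_J over the factorial ring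
   k[x_1, ..., x_n] with (a_I) and (b_J) coprime: a common factor of all the N_IJ
   would be a form without zeros outside Rad^2, which has codimension at least 2,
   hence a constant.  Then (b_J) gives the Pluecker coordinates of im u_M^j, and
   (a_I), composed with the antipode, those of im u_{M^*}^j, so that the degrees
   add up to deg N_IJ = j d.

   That every u in Rad \ Rad^2 comes from a p-point is seen as follows.  There is
   a primitive f in k[E] with u(f) = 1 on which Rad^2 vanishes; contraction with f
   is a derivation of kE taking u to a unit, so some operator D satisfies
   [D, u] = 1, and D^(p-1), up to a scalar, witnesses that kE is projective over
   k[u]/(u^p) by Higman's criterion. *)
Require Import Defs.
From HB Require Import structures.
From mathcomp Require Import all_boot all_order all_algebra all_field.
From mathcomp Require classical_sets.
From mathcomp Require Import boolp mpoly.

Set Implicit Arguments.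
Unset Strict Implicit.
Unset Printing Implicit Defensive.

Import GRing.Theory VectorInternalTheory.
Local Open Scope ring_scope.

Local Notation "u \ox v" := (tpure u v) (at level 40, left associativity).

(** * Greatest common divisors in polynomial rings *)

Section Divisibility.
Variable R : idomainType.
Implicit Types (a b c d e x y : R) (I : Type).

Definition divides a b := exists q, b = q * a.

Definition is_gcd I (f : I -> R) d :=
  forall e, divides e d <-> forall i, divides e (f i).

Definition gcd_domain :=
  forall a b, exists d, forall e, divides e d <-> divides e a /\ divides e b.

Lemma divides_refl a : divides a a.
Proof. by exists 1; rewrite mul1r. Qed.

Lemma divides0 a : divides a 0.
Proof. by exists 0; rewrite mul0r. Qed.

Lemma divides_trans b a c : divides a b -> divides b c -> divides a c.
Proof. by move=> [q ->] [r ->]; exists (r * q); rewrite mulrA. Qed.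

Lemma divides_mull c a b : divides a b -> divides a (c * b).
Proof. by move=> [q ->]; exists (c * q); rewrite mulrA. Qed.

Lemma divides_mulr c a b : divides a b -> divides a (b * c).
Proof. by rewrite mulrC; exact: divides_mull. Qed.

Lemma dividesD a b c : divides a b -> divides a c -> divides a (b + c).
Proof. by move=> [q ->] [r ->]; exists (q + r); rewrite mulrDl. Qed.

Lemma divides_mul2l c a b : divides a b -> divides (c * a) (c * b).
Proof. by move=> [q ->]; exists q; rewrite mulrCA. Qed.

Lemma divides_pmul2l c a b : c != 0 -> divides (c * a) (c * b) -> divides a b.
Proof.
by move=> c0 [q]; rewrite mulrCA => /(mulfI c0) ->; exists q.
Qed.

Lemma divides1_unit a : divides a 1 <-> a \is a GRing.unit.
Proof.
split=> [[q q1]|ua]; first by apply/unitrPr; exists q; rewrite mulrC.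
by exists a^-1; rewrite mulVr.
Qed.

Lemma is_gcd_dvd I (f : I -> R) d i : is_gcd f d -> divides d (f i).
Proof. by move=> dP; have [H _] := dP d; exact: H (divides_refl d) i. Qed.

Hypothesis gcdR : gcd_domain.

Lemma is_gcd_exists (I : finType) (f : I -> R) : exists d, is_gcd f d.
Proof.
suff H (s : seq I) :
    exists d, forall e, divides e d <-> forall i, i \in s -> divides e (f i).
  have [d dP] := H (enum I); exists d => e.
  by rewrite dP; split=> fe i; [apply: fe; rewrite mem_enum|move=> _; exact: fe].
elim: s => [|i s [d dP]]; first by exists 0 => e; split=> // _; exact: divides0.
have [d' d'P] := gcdR (f i) d; exists d' => e; split=> [/d'P[ei /dP es] j|es].
  by rewrite inE => /orP[/eqP->|/es].
apply/d'P; split; first by apply: es; exact: mem_head.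
by apply/dP => j js; apply: es; rewrite inE js orbT.
Qed.

Lemma is_gcd_scale (I : finType) (f : I -> R) c d :
  is_gcd f d -> is_gcd (fun i => c * f i) (c * d).
Proof.
have [->|c0] := eqVneq c 0 => df.
  by move=> e; split=> [_ i|_]; rewrite mul0r; exact: divides0.
have [g gP] := is_gcd_exists (fun i => c * f i).
have cdg : divides (c * d) g.
  by apply/gP => i; apply: divides_mul2l; exact: is_gcd_dvd.
have gcd : divides g (c * d).
  case: (cdg) => q gE; suff: divides (q * d) d.
    by rewrite gE mulrCA => qd; exact: divides_mul2l.
  apply/df => i; apply: (divides_pmul2l c0).
  by rewrite mulrCA -gE; exact: (is_gcd_dvd i gP).
move=> e; split=> [e_cd i|ei]; last by apply: divides_trans gcd; apply/gP.
by apply: divides_trans e_cd _; apply: divides_mul2l; exact: is_gcd_dvd.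
Qed.

Lemma coprime_divides_mul a b c :
  (forall e, divides e a -> divides e b -> divides e 1) ->
  divides a (b * c) -> divides a c.
Proof.
move=> ab a_bc; have gab : is_gcd (fun i : bool => if i then a else b) 1.
  move=> e; split=> [e1 i|eab]; last exact: ab (eab true) (eab false).
  by rewrite -[X in divides e X]mulr1; exact: divides_mull.
have /(_ a)[_] := is_gcd_scale c gab; rewrite mulr1; apply=> -[].
  exact/divides_mull/divides_refl.
by rewrite mulrC.
Qed.

End Divisibility.

Section PolyGcd.
Variable R : idomainType.
Hypothesis gcdR : gcd_domain R.
Implicit Types (p q r : {poly R}) (c e : R).

Lemma dividesCP e p : divides e%:P p <-> forall i, divides e p`_i.
Proof.
split=> [[q ->] i|ep]; first by rewrite coefMC; exists q`_i.
have: exists s : seq R, forall i, (i < size p)%N -> p`_i = s`_i * e.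
  elim: (size p) => [|n [s IH]]; first by exists [::].
  have [c cE] := ep n.
  exists (set_nth 0 s n c) => i; rewrite ltnS leq_eqVlt nth_set_nth /=.
  by case: eqP => [->|_] //=; exact: IH.
case=> s sP; exists (\poly_(i < size p) s`_i); apply/polyP => i.
rewrite coefMC coef_poly; case: ltnP => [/sP //|].
by move=> pi; rewrite nth_default // mul0r.
Qed.

Definition primitive p := forall e, divides e%:P p -> divides e 1.

Lemma primitive_neq0 p : primitive p -> p != 0.
Proof.
move=> pp; apply/eqP => p0; have /pp[q] : divides 0%:P p.
  by exists 0; rewrite p0 mul0r.
by rewrite mulr0 => /eqP; rewrite oner_eq0.
Qed.

Lemma primitive_gcd p : primitive p -> is_gcd (fun i : 'I_(size p) => p`_i) 1.
Proof.
move=> pp e; split=> [e1 i|ep].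
  by rewrite -[X in divides e X]mulr1; exact: divides_mull.
apply/pp/dividesCP => i; have [lt_i|ge_i] := ltnP i (size p).
  exact: ep (Ordinal lt_i).
by rewrite nth_default //; exact: divides0.
Qed.

Lemma dividesC_primitive e c q :
  primitive q -> divides e%:P (c%:P * q) -> divides e c.
Proof.
move=> /primitive_gcd /(is_gcd_scale gcdR c) /(_ e) [_ H] /dividesCP ecq.
by rewrite -[c]mulr1; apply: H => i; have := ecq i; rewrite coefCM.
Qed.

Lemma primitive_decomp p : p != 0 ->
  exists c q, [/\ c != 0, primitive q & p = c%:P * q].
Proof.
move=> p0; have [c cP] := is_gcd_exists gcdR (fun i : 'I_(size p) => p`_i).
have [q pE] : divides c%:P p.
  apply/dividesCP => i; have [lt_i|ge_i] := ltnP i (size p).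
    exact: (is_gcd_dvd (Ordinal lt_i) cP).
  by rewrite nth_default //; exact: divides0.
have c0 : c != 0 by apply: contra_neq p0; rewrite pE => ->; rewrite mulr0.
exists c, q; rewrite pE [in RHS]mulrC; split=> // e [r qE].
apply: (divides_pmul2l c0); rewrite mulr1; apply/cP => i.
have /(congr1 (fun s : {poly R} => s`_i)) : p = r * (c * e)%:P.
  by rewrite pE qE -mulrA -polyCM [e * c]mulrC.
by rewrite coefMC => ->; exists r`_i.
Qed.

(* A common divisor of the coefficients of p q, made coprime to the leading
   coefficient of p or of q, divides p or q without its leading term times the
   other factor, which the induction hypothesis controls. *)
Lemma primitiveM p q : primitive p -> primitive q -> primitive (p * q).
Proof.
have [n] := ubnP (size p + size q); elim: n => // n IH in p q *.
rewrite ltnS => le_n pp pq.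
have step (f g : {poly R}) e : (size f + size g <= n)%N -> primitive f ->
    primitive g -> divides e%:P (f * g) -> divides e (lead_coef f) ->
    divides e 1.
  move=> le_fg pf pg efg el; apply: (pf).
  have f0 := primitive_neq0 pf.
  pose f1 := f - lead_coef f *: 'X^((size f).-1).
  have e1 : divides e%:P (lead_coef f *: 'X^((size f).-1)).
    by apply/dividesCP => i; rewrite coefZ; exact: divides_mulr.
  rewrite -[f](subrK (lead_coef f *: 'X^((size f).-1))) -/f1; apply: dividesD => //.
  have ef1g : divides e%:P (f1 * g).
    rewrite mulrBl -mulNr; apply: dividesD => //; rewrite mulNr -mulrN.
    exact: divides_mulr.
  have [->|f10] := eqVneq f1 0; first exact: divides0.
  have [c [r [c0 pr f1E]]] := primitive_decomp f10.
  have lt_f1 : (size f1 < size f)%N.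
    rewrite ltnNge; apply/negP => le_f.
    have: f1`_(size f1).-1 != 0 by rewrite -lead_coefE lead_coef_eq0.
    have le1 : (size f1 <= size f)%N.
      rewrite (leq_trans (size_polyD _ _)) // geq_max leqnn size_polyN.
      rewrite (leq_trans (size_scale_leq _ _)) // size_polyXn.
      by rewrite prednK // size_poly_gt0.
    have -> : size f1 = size f by apply/eqP; rewrite eqn_leq le1.
    by rewrite coefB coefZ coefXn eqxx mulr1 lead_coefE subrr eqxx.
  have szr : (size r <= size f1)%N.
    by rewrite f1E mul_polyC size_scale.
  have /dividesC_primitive : primitive (r * g).
    apply: IH => //; apply: leq_trans le_fg.
    by rewrite ltn_add2r (leq_ltn_trans szr).
  move=> /(_ e c); rewrite mulrA -f1E => /(_ ef1g) ec.
  by rewrite f1E; apply/dividesCP => i; rewrite coefCM; exact: divides_mulr.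
move=> c cpq.
have cl : divides c (lead_coef p * lead_coef q).
  by move/dividesCP: cpq => /(_ (size (p * q)).-1); rewrite -lead_coefE lead_coefM.
have sub e : divides e c -> divides e%:P (p * q).
  move=> ec; apply/dividesCP => i; apply: divides_trans ec _.
  by move/dividesCP: cpq; apply.
have /(coprime_divides_mul gcdR) : forall e, divides e c ->
    divides e (lead_coef p) -> divides e 1.
  by move=> e /sub epq el; exact: (step p q).
move=> /(_ _ cl) cq; apply: (step q p) => //; first by rewrite addnC.
by rewrite mulrC.
Qed.

Lemma primitive_divides (a : R) p q r : primitive q -> a != 0 ->
  a *: p = r * q -> divides q p.
Proof.
move=> pq a0 apE; have a0' : a%:P != 0 by rewrite polyC_eq0.
move: apE; rewrite -mul_polyC => apE; have [->|p0] := eqVneq p 0; first exact: divides0.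
have r0 : r != 0.
  apply: contra_neq p0 => r0; apply: (mulfI a0').
  by rewrite apE r0 mul0r mulr0.
have [c [r' [c0 pr' rE]]] := primitive_decomp r0.
have [b cE] : divides a c.
  apply: (dividesC_primitive (primitiveM pr' pq)).
  by rewrite mulrA -rE -apE mulrC; exists p.
exists (b%:P * r'); apply: (mulfI a0').
by rewrite apE rE cE polyCM !mulrA [a%:P * _]mulrC.
Qed.

Lemma gcd_domain_poly : gcd_domain {poly R}.
Proof.
move=> p q; have [->|p0] := eqVneq p 0.
  by exists q => e; split=> [|[]//] ?; split=> //; exact: divides0.
have [->|q0] := eqVneq q 0.
  by exists p => e; split=> [|[]//] ?; split=> //; exact: divides0.
have [cp [p' [cp0 pp' pE]]] := primitive_decomp p0.
have [cq [q' [cq0 pq' qE]]] := primitive_decomp q0.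
have g0 : gcdp p q != 0 by rewrite gcdp_eq0 (negPf p0).
have [cg [g [cg0 pg gE]]] := primitive_decomp g0.
have [c cP] := gcdR cp cq.
have main r cr r' : cr != 0 -> primitive r' -> r = cr%:P * r' ->
    (gcdp p q %| r)%R -> divides c cr -> divides (c%:P * g) r.
  move=> cr0 pr' rE /Pdiv.Idomain.dvdpP [[a s] /= a0 asE] ccr.
  have [t rtE] : divides g r.
    by apply: (primitive_divides pg a0 (r := s * cg%:P)); rewrite -mulrA -gE.
  have t0 : t != 0.
    apply/eqP => t0; move: pr' => /primitive_neq0/eqP; apply.
    apply: (@mulfI _ cr%:P); first by rewrite polyC_eq0.
    by rewrite -rE rtE t0 mul0r mulr0.
  have [ct [t' [ct0 pt' tE]]] := primitive_decomp t0.
  have : divides cr ct.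
    apply: (dividesC_primitive (primitiveM pt' pg)).
    by rewrite mulrA -tE -rtE rE mulrC; exists r'.
  move=> /(divides_trans ccr)[b ctE].
  by exists (b%:P * t'); rewrite rtE tE ctE polyCM; rewrite !mulrA [_ * c%:P * t']mulrAC.
have [ccp ccq] : divides c cp /\ divides c cq by apply/cP; exact: divides_refl.
exists (c%:P * g) => h; split=> [hd|[hp hq]].
  split; apply: (divides_trans hd).
    exact: (main _ cp p' cp0 pp' pE (Pdiv.Idomain.dvdp_gcdl _ _) ccp).
  exact: (main _ cq q' cq0 pq' qE (Pdiv.Idomain.dvdp_gcdr _ _) ccq).
have h0 : h != 0.
  by apply/eqP => h0; case: hp => r; rewrite h0 mulr0 => /eqP; rewrite (negPf p0).
have [ch [h' [ch0 ph' hE]]] := primitive_decomp h0.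
have sub r cr r' : primitive r' -> r = cr%:P * r' -> divides h r ->
    divides ch cr.
  move=> pr' rE [s rsE]; apply: (dividesC_primitive pr'); rewrite -rE rsE hE.
  by exists (s * h'); rewrite mulrA mulrAC.
have chc : divides ch c.
  by apply/cP; split; [exact: sub pp' pE hp|exact: sub pq' qE hq].
have : (h %| gcdp p q)%R.
  rewrite dvdp_gcd; case: hp hq => [r ->] [s ->].
  by rewrite !dvdp_mull.
move=> /Pdiv.Idomain.dvdpP[[a s] /= a0 asE].
have [u gu] : divides h' g.
  apply: (@primitive_divides (a * cg) _ _ (s * ch%:P)) => //.
    by rewrite mulf_neq0.
  by rewrite -scalerA -mul_polyC -mul_polyC -gE mul_polyC asE hE mulrA.
case: chc => b ->; exists (b%:P * u).
by rewrite gu hE polyCM !mulrA [_ * ch%:P * u]mulrAC.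
Qed.

End PolyGcd.

Lemma gcd_domain_iso (R S : idomainType) (f : {rmorphism R -> S}) (g : S -> R) :
  cancel f g -> cancel g f -> gcd_domain S -> gcd_domain R.
Proof.
move=> fK gK gcdS a b; have [d dP] := gcdS (f a) (f b).
have fdiv x y : divides (f x) (f y) <-> divides x y.
  split=> [[q yE]|[q ->]]; last by rewrite rmorphM; exists (f q).
  by exists (g q); apply: (can_inj fK); rewrite rmorphM gK.
by exists (g d) => e; rewrite -fdiv gK dP !fdiv.
Qed.

Section MpolyGcd.
Variable k : fieldType.

Section Uni.
Variable n : nat.

Definition mpoly_of_uni (q : {poly {mpoly k[n]}}) : {mpoly k[n.+1]} :=
  (map_poly (@mwiden n k) q).['X_ord_max].

Lemma mpoly_of_uniM : {morph mpoly_of_uni : p q / p * q}.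
Proof. by move=> p q; rewrite /mpoly_of_uni rmorphM hornerM. Qed.

Lemma mpoly_of_uniD : {morph mpoly_of_uni : p q / p + q}.
Proof. by move=> p q; rewrite /mpoly_of_uni rmorphD hornerD. Qed.

Lemma mpoly_of_uniC c : mpoly_of_uni c%:P = mwiden c.
Proof. by rewrite /mpoly_of_uni map_polyC hornerC. Qed.

Lemma mpoly_of_uniX : mpoly_of_uni 'X = 'X_ord_max.
Proof. by rewrite /mpoly_of_uni map_polyX hornerX. Qed.

Lemma mpoly_of_uniXn i : mpoly_of_uni 'X^i = 'X_ord_max ^+ i.
Proof. by rewrite /mpoly_of_uni map_polyXn hornerXn. Qed.

Lemma muniK : cancel (@muni n k) mpoly_of_uni.
Proof.
elim/mpolyind => [|c m p _ _ IH].
  by rewrite muni0 /mpoly_of_uni rmorph0 horner0.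
rewrite muniD muniZ mpoly_of_uniD IH; congr (_ + p).
rewrite -mul_polyC mpoly_of_uniM mpoly_of_uniC mwidenC mul_mpolyC.
congr (_ *: _); rewrite muniE msuppX big_seq1 mcoeffX eqxx scale1r.
rewrite -mul_polyC mpoly_of_uniM mpoly_of_uniC mpoly_of_uniXn mwidenX.
rewrite mpolyXn -mpolyXD; congr 'X_[_]; apply/mnmP => i.
rewrite mnmDE mulmnE mnm1E.
have [j ->|->] := unliftP ord_max i.
  rewrite -[lift _ _](_ : widen_ord (leqnSn n) j = _); last first.
    by apply/val_inj; rewrite /= /bump leqNgt ltn_ord.
  rewrite mnmwiden_widen mnmE; case: eqP => [E|_]; last by rewrite mul0n addn0.
  by have := ltn_ord j; rewrite -[X in (_ < X)%N]/(val (@ord_max n)) E ltnn.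
by rewrite mnmwiden_ordmax eqxx mul1n.
Qed.

Lemma mpoly_of_uniK : cancel mpoly_of_uni (@muni n k).
Proof.
have muniXm (m : 'X_{1..n.+1}) : muni 'X_[m] =
    'X_[[multinom (m (widen_ord (leqnSn n) i)) | i < n]] *: 'X^(m ord_max)
    :> {poly {mpoly k[n]}}.
  by rewrite muniE msuppX big_seq1 mcoeffX eqxx scale1r.
have muniXmax : muni 'X_(@ord_max n) = 'X :> {poly {mpoly k[n]}}.
  rewrite muniXm mnm1E eqxx (_ : [multinom _ | i < n] = 0%MM).
    by rewrite mpolyX0 scale1r.
  apply/mnmP => i; rewrite mnmE mnm1E mnm0E; case: eqP => // E.
  by have := ltn_ord i; rewrite -[X in (X < _)%N]/(val (widen_ord (leqnSn n) i)) -E ltnn.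
have muni_widen c : muni (mwiden c) = c%:P :> {poly {mpoly k[n]}}.
  elim/mpolyind: c => [|c m p _ _ IH]; first by rewrite mwiden0 muni0.
  rewrite mwidenD muniD IH polyCD; congr (_ + _).
  rewrite mwidenZ mwidenX muniZ muniXm mnmwiden_ordmax expr0.
  rewrite -mul_mpolyC polyCM -mul_polyC; congr (_ * _).
  rewrite -mul_polyC mulr1; congr ('X_[_])%:P.
  by apply/mnmP => i; rewrite mnmE mnmwiden_widen.
elim/poly_ind => [|q c IH]; first by rewrite /mpoly_of_uni rmorph0 horner0 muni0.
rewrite mpoly_of_uniD mpoly_of_uniM mpoly_of_uniX mpoly_of_uniC.
by rewrite muniD muniM IH muniXmax muni_widen.
Qed.

End Uni.

Lemma gcd_domain_mpoly n : gcd_domain {mpoly k[n]}.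
Proof.
elim: n => [|n IH]; last first.
  apply: (gcd_domain_iso (f := @muni n k) (@muniK n) (@mpoly_of_uniK n)).
  exact: gcd_domain_poly.
move=> a b; have [->|a0] := eqVneq a 0.
  by exists b => e; split=> [|[]//] ?; split=> //; exact: divides0.
have ua : a \is a GRing.unit.
  have aC := nvar0_mpolyC a; move: a0; rewrite aC mpolyC_eq0 => a0; apply/divides1_unit.
  by exists (a@_0)^-1%:MP; rewrite -mpolyCM mulVf.
exists a => e; split=> [ea|[]//]; split=> //.
apply: divides_trans ea _; rewrite -[b]mulr1; apply: divides_mull.
exact/divides1_unit.
Qed.

End MpolyGcd.

(** * Homogeneous polynomials *)

Section Homogeneous.
Variables (k : fieldType) (n : nat).
Implicit Types p q g : {mpoly k[n]}.

Lemma meval_homog e p (c : k) (v : 'I_n -> k) : p \is e.-homog ->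
  p.@[fun i => c * v i] = c ^+ e * p.@[v].
Proof.
move=> /dhomogP ph; rewrite !mevalE mulr_sumr !big_seq; apply: eq_bigr => m mp.
rewrite mulrCA; congr (_ * _).
have <- : mdeg m = e := ph m mp.
rewrite mdegE -prodrXr -big_split.
by apply: eq_bigr => i _; rewrite exprMn.
Qed.

(* The substitution x_i |-> x_i T, whose T-coefficients are the homogeneous
   components. *)
Definition homogenize : {mpoly k[n]} -> {poly {mpoly k[n]}} :=
  mmap (polyC \o @mpolyC n k) (fun i => ('X_i)%:P * 'X).

Lemma homogenizeM p q : homogenize (p * q) = homogenize p * homogenize q.
Proof. exact: rmorphM. Qed.

Lemma homogenizeD p q : homogenize (p + q) = homogenize p + homogenize q.
Proof. exact: mmapD. Qed.

Lemma homogenizeZ c p : homogenize (c *: p) = c%:MP *: homogenize p.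
Proof. by rewrite /homogenize mmapZ mul_polyC. Qed.

Lemma homogenize0 : homogenize 0 = 0.
Proof. exact: mmap0. Qed.

Lemma homogenizeX m : homogenize 'X_[m] = 'X_[m] *: 'X^(mdeg m).
Proof.
rewrite /homogenize mmapX /mmap1 mpolyXE_id mdegE -mul_polyC -prodrXr.
rewrite rmorph_prod -big_split; apply: eq_bigr => i _ /=.
by rewrite exprMn -rmorphXn.
Qed.

Lemma coef_homogenize p i : (homogenize p)`_i = pihomog mdeg i p.
Proof.
elim/mpolyind: p => [|c m p _ _ IH]; first by rewrite homogenize0 coef0 pihomog0.
have -> : pihomog mdeg i (c *: 'X_[m] + p)
    = c *: pihomog mdeg i 'X_[m] + pihomog mdeg i p.
  exact: pihomog_is_linear.
rewrite homogenizeD coefD; congr (_ + _); last exact: IH.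
rewrite pihomogX homogenizeZ homogenizeX !coefZ coefXn -mul_mpolyC; congr (_ * _).
by rewrite eq_sym /=; case: eqP => _; rewrite ?mulr1 ?mulr0.
Qed.

Lemma homogenize_homog e p : p \is e.-homog -> homogenize p = p *: 'X^e.
Proof.
move=> ph; apply/polyP => i; rewrite coef_homogenize coefZ coefXn.
have [->|ne] := eqVneq i e; first by rewrite mulr1 pihomog_dE.
by rewrite mulr0 (pihomog_ne0 _ ph) // eq_sym.
Qed.

Lemma homogenize1 p : (homogenize p).[1] = p.
Proof.
elim/mpolyind: p => [|c m p _ _ IH]; first by rewrite homogenize0 horner0.
rewrite homogenizeD hornerD; congr (_ + _); last exact: IH.
rewrite homogenizeZ homogenizeX.
by rewrite !hornerZ hornerXn expr1n mulr1 mul_mpolyC.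
Qed.

Lemma homog_homogenize e p q : homogenize p = q *: 'X^e -> p \is e.-homog.
Proof.
move=> pE; have qE : q = p.
  by rewrite -[RHS]homogenize1 pE hornerZ hornerXn expr1n mulr1.
by rewrite homog_piE -coef_homogenize pE coefZ coefXn eqxx mulr1 qE.
Qed.

Lemma homog_factors e p q : p != 0 -> q != 0 -> p * q \is e.-homog ->
  exists d d', [/\ p \is d.-homog, q \is d'.-homog & (d + d')%N = e].
Proof.
move=> p0 q0 pqh; have := homogenize_homog pqh; rewrite homogenizeM.
have h0 r : r != 0 -> homogenize r != 0.
  by apply: contra_neq => r0; rewrite -[LHS]homogenize1 r0 horner0.
have split r : r != 0 ->
    exists s a, homogenize r = s * 'X^a /\ s.[0] != 0.
  move=> /h0 r0; have [a [s +]] := multiplicity_XsubC (homogenize r) 0.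
  by rewrite r0 subr0 /= => s0 rE; exists s, a.
have [s [a [pE s0]]] := split p p0; have [t [b [qE t0]]] := split q q0.
rewrite pE qE mulrACA -exprD => E.
have st0 : (s * t).[0] != 0 by rewrite hornerM mulf_neq0.
have stn0 : s * t != 0 by apply: contra_neq st0 => ->; rewrite horner0.
have pq0 : p * q != 0 by rewrite mulf_neq0.
have abe : (a + b)%N = e.
  apply/eqP; rewrite eqn_leq; apply/andP; split; rewrite leqNgt; apply/negP => lt.
    have := congr1 (fun r : {poly _} => r`_e) E.
    by rewrite coefMXn lt coefZ coefXn eqxx mulr1 => /esym/eqP; rewrite (negPf pq0).
  have := congr1 (fun r : {poly _} => r`_(a + b)) E.
  rewrite coefMXn ltnn subnn coefZ coefXn (ltn_eqF lt) mulr0 -horner_coef0.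
  by move/eqP; rewrite (negPf st0).
move: E; rewrite abe -mul_polyC => /(mulIf (monic_neq0 (monicXn _ e))) stC.
have: size (s * t) = 1%N by rewrite stC size_polyC pq0.
have sn0 : s != 0 by apply: contra_neq s0 => ->; rewrite horner0.
have tn0 : t != 0 by apply: contra_neq t0 => ->; rewrite horner0.
move=> /eqP; rewrite size_mul_eq1 => /andP[/size_poly1P[c _ sC] /size_poly1P[d _ tC]].
exists a, b; split=> //; first by apply: (@homog_homogenize _ _ c); rewrite pE sC mul_polyC.
by apply: (@homog_homogenize _ _ d); rewrite qE tC mul_polyC.
Qed.

End Homogeneous.

Section Evaluation.
Variable k : closedFieldType.

Lemma mpoly_nonroot n (p : {mpoly k[n]}) : p != 0 -> exists v, p.@[v] != 0.
Proof.
elim: n => [|n IH] in p *.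
  by rewrite (nvar0_mpolyC p) mpolyC_eq0 => p0; exists (fun=> 0); rewrite mevalC.
rewrite -(muniK p) => p0; pose q := muni p.
have q0 : lead_coef q != 0.
  rewrite lead_coef_eq0; apply: contra_neq p0; rewrite /q => ->.
  by rewrite /mpoly_of_uni rmorph0 horner0.
have [w w0] := IH _ q0.
have /closed_nonrootP[x qx] : map_poly (meval w) q != 0.
  by rewrite -lead_coef_eq0 lead_coef_map_eq.
pose v (i : 'I_n.+1) := if unlift ord_max i is Some j then w j else x.
exists v; suff -> : (mpoly_of_uni q).@[v] = (map_poly (meval w) q).[x] by [].
have vmax : v ord_max = x by rewrite /v unlift_none.
have vw j : v (widen_ord (leqnSn n) j) = w j.
  rewrite /v (_ : widen_ord _ j = lift ord_max j) ?liftK //.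
  by apply/val_inj; rewrite /= /bump leqNgt ltn_ord.
elim/poly_ind: q {qx w0 q0 p0} => [|q c IHq].
  by rewrite /mpoly_of_uni !rmorph0 !horner0 rmorph0.
rewrite mpoly_of_uniD mpoly_of_uniM mpoly_of_uniX mpoly_of_uniC.
rewrite mevalD mevalM IHq mevalXU vmax rmorphD rmorphM /= map_polyX map_polyC.
rewrite hornerD hornerMX hornerC; congr (_ + _); rewrite -[RHS]/(c.@[w]).
elim/mpolyind: c => [|c m r _ _ IHr]; first by rewrite mwiden0 !meval0.
rewrite mwidenD mwidenZ mwidenX !mevalD IHr !mevalZ !mevalX; congr (_ * _ + _).
rewrite big_ord_recr /= mnmwiden_ordmax mulr1.
by apply: eq_bigr => i _; rewrite mnmwiden_widen vw.
Qed.

Lemma mpoly_ext n (p q : {mpoly k[n]}) : (forall v, p.@[v] = q.@[v]) -> p = q.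
Proof.
move=> pq; apply/eqP; rewrite -subr_eq0; apply/negPn/negP => /mpoly_nonroot[v].
by rewrite mevalB pq subrr eqxx.
Qed.

Lemma mpoly_ext_dense n (h p q : {mpoly k[n]}) : h != 0 ->
  (forall v, h.@[v] != 0 -> p.@[v] = q.@[v]) -> p = q.
Proof.
move=> h0 pq; apply: (mulfI h0); apply: mpoly_ext => v; rewrite !mevalM.
by have [->|/pq ->] := eqVneq h.@[v] 0; rewrite ?mul0r.
Qed.

Lemma prod_homog n (I : Type) (r : seq I) (F : I -> {mpoly k[n]}) D :
  (forall i, F i \is (D i).-homog) ->
  \prod_(i <- r) F i \is (\sum_(i <- r) D i).-homog.
Proof.
move=> Fh; elim: r => [|i r IH]; first by rewrite !big_nil dhomog1.
by rewrite !big_cons dhomogM.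
Qed.

Lemma homog_comp_linear n n' e (p : {mpoly k[n]}) (lq : n.-tuple {mpoly k[n']}) :
  (forall i, tnth lq i \is 1.-homog) -> p \is e.-homog -> p \mPo lq \is e.-homog.
Proof.
move=> lh /dhomogP ph; rewrite comp_mpolyEX big_seq.
apply: rpred_sum => m /ph <-; apply: rpredZ; rewrite comp_mpolyX /= mdegE.
by apply: prod_homog => i; rewrite -[X in X.-homog]mul1n dhomogMn.
Qed.

Lemma coprime_comp n (I : finType) (f : I -> {mpoly k[n]})
    (lq lq' : n.-tuple {mpoly k[n]}) :
  (forall v i, (tnth lq i).@[fun l => (tnth lq' l).@[v]] = v i) ->
  (forall v i, (tnth lq' i).@[fun l => (tnth lq l).@[v]] = v i) ->
  mpoly_coprime f -> mpoly_coprime (fun i => f i \mPo lq).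
Proof.
move=> lqK lqK' fc g gf.
have compK (l l' : n.-tuple {mpoly k[n]}) p :
    (forall v i, (tnth l i).@[fun l => (tnth l' l).@[v]] = v i) ->
    (p \mPo l) \mPo l' = p.
  move=> lK; apply: mpoly_ext => v; rewrite !comp_mpoly_meval.
  by apply: meval_eq => i; rewrite lK.
have : g \mPo lq' \is a GRing.unit.
  apply: fc => i; have [q qE] := gf i; exists (q \mPo lq').
  by rewrite -[LHS](compK lq lq' (f i) lqK) qE rmorphM.
by move/(rmorph_unit (comp_mpoly lq)); rewrite /= compK.
Qed.

Definition line_poly n (u v : 'I_n -> k) : {mpoly k[n]} -> {poly k} :=
  mmap polyC (fun i => (u i)%:P + v i *: 'X).

Lemma horner_line_poly n (u v : 'I_n -> k) p t :
  (line_poly u v p).[t] = p.@[fun i => u i + t * v i].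
Proof.
rewrite /line_poly /mmap mevalE horner_sum; apply: eq_bigr => m _.
rewrite hornerM hornerC horner_prod; congr (_ * _); apply: eq_bigr => i _.
by rewrite horner_exp hornerD hornerC hornerZ hornerX mulrC.
Qed.

(* Both p(u + t v) and p(t u + v) are polynomials in t without roots, hence
   constant, but p(u + t v) = t^e p(t^-1 u + v). *)
Lemma homog_nonvanishing n (u v : 'I_n -> k) e (p : {mpoly k[n]}) :
  p \is e.-homog ->
  (forall s t : k, (s, t) != (0, 0) -> p.@[fun i => s * u i + t * v i] != 0) ->
  e = 0%N.
Proof.
move=> ph nz; case: e ph => // e ph.
have size1 (x y : 'I_n -> k) : (forall t, p.@[fun i => x i + t * y i] != 0) ->
    exists2 c : k, c != 0 & forall t, p.@[fun i => x i + t * y i] = c.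
  move=> xy; have : size (line_poly x y p) == 1%N.
    apply/negPn/negP => /closed_rootP[t /rootP]; rewrite horner_line_poly => /eqP.
    by rewrite (negPf (xy t)).
  by move/size_poly1P => [c c0 E]; exists c => // t; rewrite -horner_line_poly E hornerC.
have [t|c c0 cE] := size1 u v.
  rewrite (_ : _.@[_] = p.@[fun i => 1 * u i + t * v i]).
    by apply: nz; rewrite xpair_eqE oner_eq0.
  by apply: meval_eq => i; rewrite mul1r.
have [t|d d0 dE] := size1 v u.
  rewrite (_ : _.@[_] = p.@[fun i => t * u i + 1 * v i]).
    by apply: nz; rewrite xpair_eqE oner_eq0 andbF.
  by apply: meval_eq => i; rewrite mul1r addrC.
have cd t : t != 0 -> c = t ^+ e.+1 * d.
  move=> t0; rewrite -(cE t) -(dE t^-1) -(meval_homog _ _ ph).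
  by apply: meval_eq => i; rewrite mulrDr mulVKf // addrC.
have : d *: 'X^(e.+2) - c *: 'X == 0 :> {poly k}.
  apply/negPn/negP => /closed_nonrootP[t /negP]; apply; apply/rootP.
  rewrite hornerD hornerN !hornerZ hornerXn hornerX.
  have [->|/cd ->] := eqVneq t 0; first by rewrite expr0n !mulr0 subrr.
  by rewrite exprSr mulrA [d * _]mulrC subrr.
move/eqP/polyP/(_ 1%N); rewrite coefB !coefZ coefXn coefX coef0 mulr0 mulr1 sub0r.
by move/eqP; rewrite oppr_eq0 (negPf c0).
Qed.

End Evaluation.

Section RankOne.
Variables (k : closedFieldType) (n : nat).
Local Notation R := {mpoly k[n]}.

Lemma mpoly_coprime_gcd (I : finType) (f : I -> R) :
  mpoly_coprime f <-> is_gcd f 1.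
Proof.
split=> [fP|f1 g gf]; last by apply/divides1_unit/f1 => i; exact: gf.
have [d df] := is_gcd_exists (@gcd_domain_mpoly k n) f.
have /divides1_unit d1 : d \is a GRing.unit.
  by apply: fP => i; exact: is_gcd_dvd df.
move=> e; split=> [e1 i|/df ed]; last exact: divides_trans ed d1.
by rewrite -[f i]mulr1; exact: divides_mull.
Qed.

Lemma unit_homog0 (g : R) : g \is 0.-homog -> g != 0 -> g \is a GRing.unit.
Proof.
move=> /dhomogP g0 gn0; have gC : g = (g@_0)%:MP.
  apply/mpolyP => m; rewrite mcoeffC; have [->|m0] := eqVneq 0%MM m; first by rewrite mulr1.
  rewrite mulr0; apply/eqP; rewrite mcoeff_eq0; apply: contra m0 => /g0/eqP.
  by rewrite mdeg_eq0 eq_sym.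
apply/divides1_unit; exists (g@_0)^-1%:MP; rewrite {2}gC -mpolyCM mulVf //.
by move: gn0; rewrite gC mpolyC_eq0 mcoeffC eqxx mulr1.
Qed.

Lemma coprime_proportional (I : finType) (f f' : I -> R) i :
  mpoly_coprime f -> mpoly_coprime f' ->
  (forall i j, f i * f' j = f j * f' i) -> divides (f i) (f' i).
Proof.
move=> /mpoly_coprime_gcd fc _ ff'.
have /(is_gcd_scale (@gcd_domain_mpoly k n) (f' i)) fi := fc.
rewrite -[f' i]mulr1; apply/fi => j.
by rewrite mulrC -ff'; exists (f' j); rewrite mulrC.
Qed.

Lemma coprime_proportional_degree (I : finType) (f f' : I -> R) e e' i :
  mpoly_coprime f -> mpoly_coprime f' ->
  (forall i, f i \is e.-homog) -> (forall i, f' i \is e'.-homog) ->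
  (forall i j, f i * f' j = f j * f' i) -> f i != 0 -> f' i != 0 -> e = e'.
Proof.
move=> fc fc' fh fh' ff' fi0 fi0'.
have le (g g' : I -> R) d d' : divides (g i) (g' i) -> g i \is d.-homog ->
    g' i \is d'.-homog -> g i != 0 -> g' i != 0 -> (d <= d')%N.
  move=> [q qE] gh gh' gi0 gi0'.
  have q0 : q != 0 by apply: contra_neq gi0' => q0; rewrite qE q0 mul0r.
  move: gh'; rewrite qE => /(homog_factors q0 gi0)[a [b [_ gb <-]]].
  by rewrite (dhomog_uniq gi0 gh gb) leq_addl.
apply/eqP; rewrite eqn_leq; apply/andP; split.
  exact: (le f f') (coprime_proportional _ fc fc' ff') (fh i) (fh' i) _ _.
apply: (le f' f) (coprime_proportional i fc' fc _) (fh' i) (fh i) _ _ => //.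
by move=> j l; rewrite mulrC -ff' mulrC.
Qed.

Lemma gcd_split (I : finType) (f : I -> R) i0 : f i0 != 0 ->
  exists (g : R) (h : I -> R), [/\ g != 0, is_gcd h 1 & forall i, f i = g * h i].
Proof.
move=> fi0; have [g gf] := is_gcd_exists (@gcd_domain_mpoly k n) f.
have g0 : g != 0.
  by have [q qE] := is_gcd_dvd i0 gf; apply: contra_neq fi0 => g0; rewrite qE g0 mulr0.
have /fin_all_exists[h hE] : forall i, exists q, f i = q * g.
  by move=> i; exact: is_gcd_dvd gf.
exists g, h; split=> // [e|i]; last by rewrite mulrC.
split=> [e1 i|eh]; first by rewrite -[h i]mulr1; exact: divides_mull.
apply: (divides_pmul2l g0); rewrite mulr1; apply/gf => i.
by rewrite hE [h i * g]mulrC; exact: divides_mul2l.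
Qed.

Lemma homog_rank1_factor (I J : finType) (N : I -> J -> R) D (u v : 'I_n -> k) :
  (forall i j, N i j \is D.-homog) ->
  (forall i j i' j', N i j * N i' j' = N i j' * N i' j) ->
  (forall s t : k, (s, t) != (0, 0) ->
    exists i j, (N i j).@[fun l => s * u l + t * v l] != 0) ->
  exists a b d e, [/\ mpoly_coprime a, mpoly_coprime b,
    (forall i, a i \is d.-homog) /\ (forall j, b j \is e.-homog),
    (d + e)%N = D & forall i j, N i j = a i * b j].
Proof.
move=> Nh N1 Nuv; have gcdR := @gcd_domain_mpoly k n.
have [|i0 [j0 Nij0]] := Nuv 1 0; first by rewrite xpair_eqE oner_eq0.
have N0 : N i0 j0 != 0 by apply: contra_neq Nij0 => ->; rewrite meval0.
have [g [a [g0 ac aE]]] := gcd_split (f := fun i => N i j0) N0.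
have ai0 : a i0 != 0 by apply: contra_neq N0 => a0; rewrite aE a0 mulr0.
have Na i j i' : N i j * a i' = a i * N i' j.
  by apply: (mulfI g0); rewrite mulrCA -aE mulrA -aE N1.
have /fin_all_exists[b bE] : forall j, exists q : R, N i0 j = q * a i0.
  move=> j; have /(is_gcd_scale gcdR (N i0 j)) h := ac.
  by rewrite -[N i0 j]mulr1; apply/h => i'; rewrite Na mulrC; exists (N i' j).
have NE i j : N i j = a i * b j.
  by apply: (mulIf ai0); rewrite Na bE mulrA.
have b0 : b j0 != 0 by apply: contra_neq N0 => b0; rewrite NE b0 mulr0.
have [c [b' [c0 bc b'E]]] := gcd_split b0.
have b'0 : b' j0 != 0 by apply: contra_neq b0 => b0; rewrite b'E b0 mulr0.
have hom i j : a i != 0 -> b' j != 0 -> exists d e f,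
    [/\ a i \is d.-homog, c \is e.-homog, b' j \is f.-homog & (d + (e + f))%N = D].
  move=> ai bj; have := Nh i j; rewrite NE b'E.
  case/homog_factors => //; first by rewrite mulf_neq0.
  move=> d [m [ad + <-]]; case/homog_factors => // e [f [ce bf <-]].
  by exists d, e, f.
have [d [e [f [ad ce bf defD]]]] := hom i0 j0 ai0 b'0.
have e0 : e = 0%N.
  apply: (homog_nonvanishing ce (u := u) (v := v)) => s t /Nuv[i [j]].
  by rewrite NE b'E !mevalM !mulf_eq0 !negb_or => /and3P[].
subst e; have cu : c \is a GRing.unit by exact: unit_homog0.
have ah i : a i \is d.-homog.
  have [->|ai] := eqVneq (a i) 0; first exact: dhomog0.
  have [d' [e' [f' [ad' ce' bf' E]]]] := hom i j0 ai b'0.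
  move: E; rewrite -(dhomog_uniq c0 ce ce') -(dhomog_uniq b'0 bf bf') -defD.
  by move/addIn <-.
have bh j : b j \is f.-homog.
  rewrite b'E; have [->|bj] := eqVneq (b' j) 0; first by rewrite mulr0 dhomog0.
  have [d' [e' [f' [ad' ce' bf' E]]]] := hom i0 j ai0 bj.
  move: E; rewrite -(dhomog_uniq c0 ce ce') -(dhomog_uniq ai0 ad ad') -defD.
  move/addnI/addnI => ff'; rewrite -(add0n f); apply: dhomogM => //.
  by rewrite -ff'.
exists a, b, d, f; split=> //.
- exact/mpoly_coprime_gcd.
- move=> h hb; apply/divides1_unit/bc => j; have [q qE] := hb j.
  exists (c^-1 * q); apply: (mulfI c0); rewrite -b'E qE mulrA mulrA.
  by rewrite mulrV // mul1r.
Qed.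

End RankOne.

(** * Minors and Pluecker coordinates *)

Section Minors.
Variable d : nat.

Definition minor (R : comNzRingType) m1 m2 (X : 'M[R]_(m1, m2))
    (I : incr_map d m1) (J : incr_map d m2) : R :=
  \det (mxsub (val I) (val J) X).

Lemma minor_map (R S : comNzRingType) (f : {rmorphism R -> S}) m1 m2
    (X : 'M[R]_(m1, m2)) I J :
  minor (map_mx f X) I J = f (minor X I J).
Proof. by rewrite /minor -det_map_mx map_mxsub. Qed.

Lemma minor_mul (R : comNzRingType) m1 m2 (L : 'M[R]_(m1, d)) (V : 'M[R]_(d, m2)) I J :
  minor (L *m V) I J = \det (rowsub (val I) L) * \det (colsub (val J) V).
Proof.
rewrite /minor -det_mulmx; congr (\det _); apply/matrixP => a b.
by rewrite !mxE; apply: eq_bigr => c _; rewrite !mxE.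
Qed.

Lemma incr_map_image (m : nat) (f : 'I_d -> 'I_m) : injective f ->
  exists h : incr_map d m, forall a, exists b, f a = val h b.
Proof.
move=> finj; pose S := [set f a | a : 'I_d].
have cS : #|S| = d by rewrite card_imset // card_ord.
pose h : {ffun 'I_d -> 'I_m} := [ffun a => enum_val (cast_ord (esym cS) a)].
have hP : [forall a : 'I_d, forall b : 'I_d, (a < b)%N ==> (h a < h b)%N].
  apply/forallP => a; apply/forallP => b; apply/implyP => ab; rewrite !ffunE.
  have x0 := h a.
  have srt : sorted ltn (map val (enum S)).
    have -> : enum S = filter (mem S) (enum 'I_m) by rewrite enumT.
    apply: (@subseq_sorted _ _ ltn_trans _ (map val (enum 'I_m))).
      exact/map_subseq/filter_subseq.
    by rewrite val_enum_ord iota_ltn_sorted.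
  rewrite !(enum_val_nth x0) -!(nth_map x0 0%N val) -?cardE ?ltn_ord //.
  by apply: (sorted_ltn_nth ltn_trans) => //; rewrite inE size_map -cardE ltn_ord.
exists (Sub h hP) => a.
have fS : f a \in S by apply: imset_f.
exists (cast_ord cS (enum_rank_in fS (f a))); rewrite SubK ffunE.
by rewrite cast_ordK enum_rankK_in.
Qed.

Lemma row_full_det_neq0 (F : fieldType) m (L : 'M[F]_(m, d)) : row_full L ->
  exists I : incr_map d m, \det (rowsub (val I) L) != 0.
Proof.
move=> Lf; have [h hP] := incr_map_image (@fullrankfun_inj _ _ _ _ Lf).
exists h; rewrite -unitfE -unitmxE -row_full_unit -sub1mx.
apply: (@submx_trans _ _ _ _ _ _ L); first by rewrite sub1mx.
rewrite -(eq_fullrowsub Lf); apply/row_subP => a; rewrite row_rowsub.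
by have [b ->] := hP a; rewrite -row_rowsub row_sub.
Qed.

Lemma row_free_det_neq0 (F : fieldType) m (V : 'M[F]_(d, m)) : row_free V ->
  exists J : incr_map d m, \det (colsub (val J) V) != 0.
Proof.
rewrite /row_free -mxrank_tr => /row_full_det_neq0[J]; rewrite -det_tr => nz.
exists J; rewrite (_ : colsub _ _ = (rowsub (val J) V^T)^T) //.
by apply/matrixP => a b; rewrite !mxE.
Qed.

End Minors.

Lemma vlineZ (k : fieldType) (V : vectType k) (c : k) (v : V) :
  c != 0 -> <[c *: v]>%VS = <[v]>%VS.
Proof.
move=> c0; apply/eqP; rewrite eqEsubv -!memvE memvZ ?memv_line //=.
by apply/vlineP; exists c^-1; rewrite scalerA mulVf // scale1r.
Qed.

Section Pluecker.
Variables (k : fieldType) (M : vectType k) (d : nat).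

Lemma pluecker_minors (W : {vspace M}) m (vs : 'I_m -> M) :
  \dim W = d -> (forall l, vs l \in W) ->
  (forall w, w \in W -> exists c : 'I_m -> k, w = \sum_l c l *: vs l) ->
  exists lam : incr_map d m -> k,
    [/\ forall I J, minor (\matrix_(l, i) coord (vbasis {:M}) i (vs l)) I J
                    = lam I * wedge (fun a : 'I_d => (vbasis W)`_a) J,
        exists I, lam I != 0 &
        exists J, wedge (fun a : 'I_d => (vbasis W)`_a) J != 0].
Proof.
move=> dW; subst d => vsW Wvs.
set X := \matrix_(l, i) _.
pose V : 'M[k]_(\dim W, \dim {:M}) :=
  \matrix_(a, i) coord (vbasis {:M}) i (vbasis W)`_a.
pose L : 'M[k]_(m, \dim W) := \matrix_(l, a) coord (vbasis W) a (vs l).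
have wedgeE J : wedge (fun a : 'I_(\dim W) => (vbasis W)`_a) J = \det (colsub (val J) V).
  by rewrite ffunE; congr (\det _); apply/matrixP => a b; rewrite !mxE.
have XE : X = L *m V.
  apply/matrixP => l i; rewrite !mxE [in LHS](coord_vbasis (vsW l)) linear_sum /=.
  by apply: eq_bigr => a _; rewrite linearZ !mxE.
have Wb (a : 'I_(\dim W)) : (vbasis W)`_a \in W.
  by rewrite vbasis_mem // mem_nth // size_tuple.
have /fin_all_exists[c cE] : forall a : 'I_(\dim W),
    exists c : 'I_m -> k, (vbasis W)`_a = \sum_l c l *: vs l.
  by move=> a; exact: Wvs.
have VE : V = (\matrix_(a, l) c a l) *m X.
  apply/matrixP => a i; rewrite !mxE cE linear_sum /=.
  by apply: eq_bigr => l _; rewrite linearZ !mxE.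
have Vfree : row_free V.
  apply/row_freeP; exists (\matrix_(i, a) coord (vbasis W) a (vbasis {:M})`_i).
  apply/matrixP => a b; rewrite !mxE.
  rewrite -(coord_free a b (basis_free (vbasisP W))).
  rewrite [in RHS](coord_vbasis (memvf (vbasis W)`_a)) linear_sum /=.
  by apply: eq_bigr => i _; rewrite linearZ !mxE.
have Lfull : row_full L.
  apply/row_fullP; exists (\matrix_(a, l) c a l).
  by apply: (row_free_inj Vfree); rewrite mul1mx -mulmxA -XE -VE.
exists (fun I : incr_map (\dim W) m => \det (rowsub (val I) L)); split.
- by move=> I J; rewrite XE minor_mul wedgeE.
- exact: row_full_det_neq0.
- by have [J] := row_free_det_neq0 Vfree; exists J; rewrite wedgeE.
Qed.

Lemma line_eq (I J : finType) (lam a : I -> k) (rho : {ffun J -> k^o}) (b : J -> k) :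
  (forall i j, lam i * rho j = a i * b j) ->
  (exists i, lam i != 0) -> (exists j, rho j != 0) ->
  <[rho]>%VS = <[ [ffun j => b j : k^o] : {ffun J -> k^o} ]>%VS.
Proof.
move=> E [i li] [j rj].
have ai : a i != 0.
  apply: contra_neq (mulf_neq0 li rj) => ai.
  by rewrite E ai mul0r.
set s := [ffun j => _].
have -> : rho = (a i / lam i) *: s.
  apply/ffunP => j'; rewrite !ffunE; apply: (mulfI li).
  rewrite E; change (a i * b j' = lam i * (a i / lam i * b j')).
  by rewrite mulrA mulrCA mulfV // mulr1.
by apply: vlineZ; rewrite mulf_neq0 // invr_eq0.
Qed.

End Pluecker.

(** * The algebra of measures *)

Section LinearForms.
Variables (k : fieldType) (V : vectType k).

Lemma span_closed (P : V -> Prop) (X : seq V) :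
  P 0 -> (forall x y, P x -> P y -> P (x + y)) -> (forall c x, P x -> P (c *: x)) ->
  (forall x, x \in X -> P x) -> forall x, x \in <<X>>%VS -> P x.
Proof.
move=> P0 PD PZ PX x xX; rewrite (coord_span (X := in_tuple X) xX).
elim/big_ind: _ => // i _; apply/PZ/PX; exact: mem_nth.
Qed.

Definition coord_form (i : 'I_(\dim {:V})) : 'Hom(V, k^o) :=
  linfun (coord (vbasis {:V}) i : V -> k^o).

Lemma coord_formE i v : coord_form i v = coord (vbasis {:V}) i v.
Proof. by rewrite lfunE. Qed.

Lemma separating_form (W : {vspace V}) u : u \notin W ->
  exists F : 'Hom(V, k^o), (forall w, w \in W -> F w = 0) /\ F u = 1.
Proof.
move=> uW; pose v := u - projv W u.
have v0 : v != 0.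
  by apply: contra uW; rewrite subr_eq0 => /eqP ->; exact: memv_proj.
have [i vi] : exists i, coord (vbasis {:V}) i v != 0.
  apply/existsP; rewrite -negb_forall; apply: contra v0 => /forallP h.
  rewrite (coord_vbasis (memvf v)) big1 // => i _.
  by move: (h i) => /eqP ->; rewrite scale0r.
pose c := coord (vbasis {:V}) i v.
exists (c^-1 *: (coord_form i \o (\1 - projv W))%VF).
have FE x : (c^-1 *: (coord_form i \o (\1 - projv W))%VF) x
    = c^-1 * coord (vbasis {:V}) i (x - projv W x).
  by rewrite scale_lfunE comp_lfunE add_lfunE opp_lfunE id_lfunE coord_formE.
split=> [w wW|]; rewrite FE; last by rewrite mulVf.
by rewrite projv_id // subrr linear0 mulr0.
Qed.

Lemma form_expand (phi : 'Hom(V, k^o)) :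
  phi = \sum_(i < \dim {:V}) phi (vbasis {:V})`_i *: coord_form i.
Proof.
apply/lfunP => v; rewrite sum_lfunE {1}(coord_vbasis (memvf v)) linear_sum /=.
apply: eq_bigr => i _; rewrite linearZ scale_lfunE coord_formE.
by rewrite /= -[LHS]/(_ * _) mulrC.
Qed.

Lemma reflexive (F : 'Hom('Hom(V, k^o), k^o)) : exists v, forall phi, F phi = phi v.
Proof.
exists (\sum_(i < \dim {:V}) F (coord_form i) *: (vbasis {:V})`_i) => phi.
rewrite {1}(form_expand phi) !linear_sum /=; apply: eq_bigr => i _.
by rewrite !linearZ /= -[LHS]/(_ * _) mulrC.
Qed.

End LinearForms.

Section Measures.
Variables (k : fieldType) (E : finGroupScheme k).
Local Notation H := (measures E).
Implicit Types (u v w : H) (f g x : E).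

Lemma measM u v f : (u * v) f = tlift (fun a b => u a * v b : k^o) (comul f).
Proof. exact: meas_mulE. Qed.

Lemma meas_bilin u v : bilin (fun a b : E => u a * v b : k^o).
Proof.
split=> [a|b] c x y; first by rewrite linearP /= mulrDr -scalerAr.
by rewrite linearP /= mulrDl -scalerAl.
Qed.

Lemma meas_evalM u v : (u * v) 1 = u 1 * v 1.
Proof. by rewrite measM comul1 tlift_tpure //; exact: meas_bilin. Qed.

Lemma meas_eval1 : (1 : H) 1 = 1.
Proof. exact: counit1. Qed.

Lemma meas_evalX u n : (u ^+ n) 1 = u 1 ^+ n.
Proof.
elim: n => [|n IH]; first by rewrite !expr0 meas_eval1.
by rewrite !exprS meas_evalM IH.
Qed.

Lemma meas_mulC : abelian_scheme E -> forall u v, u * v = v * u.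
Proof.
move=> abE u v; apply/lfunP => f; rewrite !measM -[in RHS]abE.
rewrite (tlift_comp _ _ (tlift_linear _)); apply: eq_tlift => a b.
by rewrite tlift_tpure; [exact: mulrC|exact: meas_bilin].
Qed.

Lemma tens_separated (s t : tens E E) :
  (forall u v, tlift (fun a b => u a * v b : k^o) s
             = tlift (fun a b => u a * v b : k^o) t) -> s = t.
Proof.
move=> st; apply/matrixP => i j.
have lc l : linear (fun x : E => v2r x 0 l : k^o) by move=> a x y; rewrite linearP !mxE.
have coefE (r : tens E E) :
    tlift (fun a b => linfun (fun x : E => v2r x 0 i : k^o) a
                    * linfun (fun x : E => v2r x 0 j : k^o) b : k^o) r
    = (r : 'M_(_, _)) i j.
  rewrite /tlift (bigD1 i) //= [X in _ + X]big1 ?addr0 => [|i' ni].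
    rewrite (bigD1 j) //= big1 ?addr0 => [|j' nj].
      by rewrite !linfunE // !r2vK !mxE !eqxx !mulr1 -[LHS]/(_ * _) mulr1.
    by rewrite !linfunE // !r2vK !mxE eqxx eq_sym (negPf nj) !mulr0 scaler0.
  rewrite big1 // => j' _.
  by rewrite !linfunE // !r2vK !mxE eqxx eq_sym (negPf ni) mul0r scaler0.
by rewrite -!coefE st.
Qed.

Definition contract f u : H := linfun (fun g => u (f * g)).

Lemma contractE f u g : contract f u g = u (f * g).
Proof.
rewrite linfunE // => a x y.
by rewrite mulrDr -scalerAr linearP.
Qed.

Definition primitive_elt f := comul f = f \ox 1 + 1 \ox f.

Lemma contractM f u v : primitive_elt f ->
  contract f (u * v) = contract f u * v + u * contract f v.
Proof.
move=> fp; apply/lfunP => g; rewrite add_lfunE contractE !measM comulM fp.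
have B (a b : E) : bilin (fun c d : E => (a * c) \ox (b * d)).
  by apply: (bilin_comp (@tpure_bilin k E E)); exact: (mul_bilin E).1.
rewrite (linD _ _ (tlift_linear _)).
have B' : bilin (fun a b => tlift (fun c d : E => (a * c) \ox (b * d)) (comul g)).
  split=> [a|b]; apply: tlift_param_linear => c d.
    by apply: (comp_linear ((@tpure_bilin k E E).1 _)); exact: (mul_bilin E).2.
  apply: (comp_linear (f := fun s : E => s \ox (b * d))).
    exact: (@tpure_bilin k E E).2.
  exact: (mul_bilin E).2.
rewrite !tlift_tpure // (linD _ _ (tlift_linear _)).
congr (_ + _); rewrite (tlift_comp _ _ (tlift_linear _)); apply: eq_tlift => a b;
  by rewrite tlift_tpure; [rewrite ?contractE !mul1r|exact: meas_bilin].
Qed.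

Lemma contractD f u v : contract f (u + v) = contract f u + contract f v.
Proof. by apply/lfunP => g; rewrite add_lfunE !contractE add_lfunE. Qed.

Lemma primitive_eltP f :
  (forall u v, (u * v) f = u f * v 1 + u 1 * v f) -> primitive_elt f.
Proof.
move=> fP; apply: tens_separated => u v; rewrite -measM fP.
rewrite (linD _ _ (tlift_linear _)) !tlift_tpure //; exact: meas_bilin.
Qed.

Definition augmentation : {vspace H} := lker (linfun (fun u : H => u 1 : k^o)).

Lemma mem_augmentation u : (u \in augmentation) = (u 1 == 0).
Proof. by rewrite memv_ker linfunE // => a x y; rewrite add_lfunE scale_lfunE. Qed.

End Measures.

Section Subgroups.
Variables (k : fieldType) (E : finGroupScheme k) (F : subgroupScheme E).

Definition sub_incl (w : measures F) : measures E := (w \o restriction F)%VF.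

Lemma sub_inclE w f : sub_incl w f = w (restriction F f).
Proof. exact: comp_lfunE. Qed.

Lemma sub_incl_inj : injective sub_incl.
Proof.
move=> v w /lfunP vw; apply/lfunP => f.
have /memv_imgP[g _ ->] : f \in limg (restriction F) by rewrite restriction_surj memvf.
by rewrite -!sub_inclE vw.
Qed.

Lemma sub_inclM v w : sub_incl (v * w) = sub_incl v * sub_incl w.
Proof.
apply/lfunP => f; rewrite sub_inclE !measM (hopf_mor_comul (restriction_mor F)).
rewrite (tlift_comp _ _ (tlift_linear _)); apply: eq_tlift => a b.
by rewrite tlift_tpure; [rewrite !sub_inclE|exact: meas_bilin].
Qed.

Lemma sub_incl1 : sub_incl 1 = 1.
Proof.
by apply/lfunP => f; rewrite sub_inclE; exact: (hopf_mor_counit (restriction_mor F)).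
Qed.

Lemma sub_inclX v n : sub_incl (v ^+ n) = sub_incl v ^+ n.
Proof.
elim: n => [|n IH]; first by rewrite !expr0 sub_incl1.
by rewrite !exprS sub_inclM IH.
Qed.

Lemma mem_sub_measures u :
  u \in sub_measures F -> exists w, u = sub_incl w.
Proof.
case/memv_imgP => w _ ->; exists w; rewrite linfunE //.
by move=> a x y; rewrite comp_lfunDl comp_lfunZl.
Qed.

Lemma sub_measures_mulC : abelian_scheme E ->
  forall v w : measures F, v * w = w * v.
Proof.
by move=> abE v w; apply: sub_incl_inj; rewrite !sub_inclM meas_mulC.
Qed.

End Subgroups.

Lemma lfun_basis_eq (k : fieldType) (V W : vectType k) (phi psi : 'Hom(V, W)) X :
  basis_of fullv X -> (forall x, x \in X -> phi x = psi x) -> phi = psi.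
Proof.
move=> /span_basis Xf eqX; apply/lfunP => x.
apply: (span_closed (P := fun x => phi x = psi x)) (eqX) _ _; last by rewrite Xf memvf.
- by rewrite !linear0.
- by move=> y z; rewrite !linearD /= => -> ->.
- by move=> c y; rewrite !linearZ /= => ->.
Qed.

Section Frobenius.
Variables (k : fieldType) (p : nat) (H : algType k).
Hypothesis charkp : p \in [pchar k].
Hypothesis HC : forall x y : H, x * y = y * x.
Implicit Types x y : H.

Definition frob_scalar x := exists c : k, x ^+ p = c%:A.

Lemma frob_scalar0 : frob_scalar 0.
Proof. by exists 0; rewrite scale0r expr0n -leqn0 leqNgt prime_gt0 ?(pcharf_prime charkp). Qed.

Lemma frob_scalarD x y : frob_scalar x -> frob_scalar y -> frob_scalar (x + y).
Proof.
move=> [c cE] [d dE]; have charH : p \in [pchar H] by rewrite pchar_lalg.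
exists (c + d); rewrite -(pFrobenius_autE charH) pFrobenius_autD_comm; last exact: HC.
by rewrite !pFrobenius_autE cE dE scalerDl.
Qed.

Lemma frob_scalarZ a x : frob_scalar x -> frob_scalar (a *: x).
Proof. by move=> [c cE]; exists (a ^+ p * c); rewrite exprZn cE scalerA. Qed.

Lemma frob_scalarM x y : frob_scalar x -> frob_scalar y -> frob_scalar (x * y).
Proof.
move=> [c cE] [d dE]; exists (c * d); rewrite exprMn_comm; last exact: HC.
by rewrite cE dE -scalerAl mul1r scalerA.
Qed.

End Frobenius.

Section FrobeniusMeasures.
Variables (k : fieldType) (p : nat).
Hypothesis charkp : p \in [pchar k].
Let p_prime : prime p := pcharf_prime charkp.

Lemma frob_scalar_kernel (F : finGroupScheme k) r : (forall x y : measures F, x * y = y * x) ->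
  is_Ga_kernel p r F -> forall u : measures F, frob_scalar p u.
Proof.
move=> FC [t [tp _ tb]] u; exists ((u ^+ p) 1).
have derX n : contract t (u ^+ n.+1) = (u ^+ n * contract t u) *+ n.+1.
  elim: n => [|n IH]; first by rewrite expr1 expr0 mul1r.
  by rewrite exprS contractM // IH [_ * u ^+ n.+1]FC mulrnAr mulrA -exprS -mulrS.
have der0 : contract t (u ^+ p) = 0.
  rewrite -(prednK (prime_gt0 p_prime)) derX prednK ?prime_gt0 //.
  have charF : p \in [pchar (measures F)] by rewrite pchar_lalg.
  by rewrite -mulr_natl (pcharf0 charF) mul0r.
have der1 : contract t (1 : measures F) = 0.
  have := contractM 1 1 tp; rewrite !mulr1 mul1r => /eqP.
  by rewrite -subr_eq0 opprD addNKr oppr_eq0 => /eqP.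
apply: (lfun_basis_eq tb) => _ /mapP[i _ ->]; rewrite scale_lfunE.
case: i => [|i]; first by rewrite expr0 meas_eval1 -[RHS]/(_ * _) mulr1.
by rewrite exprS -!contractE der0 der1 zero_lfunE scaler0.
Qed.

Lemma frob_scalar_const (F : finGroupScheme k) : (forall x y : measures F, x * y = y * x) ->
  is_const_Zp p F -> forall u : measures F, frob_scalar p u.
Proof.
move=> FC [e [eb _ ecomul]].
pose X := [tuple of [seq e c | c : 'Z_p]].
have nX c : X`_(enum_rank c) = e c by rewrite nth_image enum_rankK.
have Xfree : free X by exact: basis_free eb.
pose g (c : 'Z_p) : measures F := linfun (coord X (enum_rank c) : F -> k^o).
have gE b c : g c (e b) = (b == c)%:R.
  by rewrite lfunE /= -nX coord_free // (inj_eq enum_rank_inj).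
have eq_meas (v w : measures F) : (forall c, v (e c) = w (e c)) -> v = w.
  by move=> vw; apply: (lfun_basis_eq eb) => _ /imageP[c _ ->].
have gM a b : g a * g b = g (a + b).
  apply: eq_meas => c; rewrite measM ecomul lin_sum; last exact: tlift_linear.
  rewrite (bigD1 a) //= big1 => [|a' na]; rewrite tlift_tpure; try exact: meas_bilin.
    by rewrite !gE eqxx mul1r addr0 subr_eq [b + a]addrC.
  by rewrite gE (negPf na) mul0r.
have expand (u : measures F) : u = \sum_c u (e c) *: g c.
  apply: eq_meas => b; rewrite sum_lfunE (bigD1 b) //= big1 => [|c nc].
    by rewrite scale_lfunE gE eqxx addr0 -[RHS]/(_ * _) mulr1.
  by rewrite scale_lfunE gE eq_sym (negPf nc) scaler0.
have g0 : g 0 = 1.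
  rewrite -[LHS]mulr1 [X in _ * X]expand mulr_sumr [RHS]expand.
  by apply: eq_bigr => c _; rewrite -scalerAr gM add0r.
have gX c n : g c ^+ n = g (c *+ n).
  elim: n => [|n IH]; first by rewrite expr0 mulr0n g0.
  by rewrite exprS IH gM mulrS.
move=> u; rewrite (expand u); elim/big_ind: _.
- exact: (@frob_scalar0 k p (measures F)).
- exact: (@frob_scalarD k p (measures F)).
move=> c _; apply: (@frob_scalarZ k p (measures F)); exists 1.
by rewrite gX -mulr_natr pchar_Zp ?prime_gt1 // mulr0 g0 scale1r.
Qed.

Lemma elementary_frob (E : finGroupScheme k) : elementary_abelian p E ->
  forall u : measures E, frob_scalar p u.
Proof.
move=> [abE [n [F [FP full]]]] u; have EC := meas_mulC abE.
have Fu i x : x \in sub_measures (F i) -> frob_scalar p x.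
  move=> /mem_sub_measures[w ->]; have FC := sub_measures_mulC (F := F i) abE.
  have [c cE] : frob_scalar p w.
    case: (FP i) => [[r _ Fi]|Fi]; first exact: (frob_scalar_kernel FC Fi).
    exact: (frob_scalar_const FC Fi).
  exists c; rewrite -sub_inclX cE; apply/lfunP => f.
  by rewrite scale_lfunE !sub_inclE scale_lfunE -(sub_incl1 (F i)) sub_inclE.
have: u \in \big[@prodv k (measures E)/1%VS]_(i < n) sub_measures (F i).
  by rewrite full memvf.
elim/big_ind: _ u => [u /vlineP[c ->]|U V PU PV u|i _ u]; last exact: Fu.
  by apply: frob_scalarZ; exists 1; rewrite expr1n scale1r.
rewrite unlock; apply: span_closed => [||c x|x /allpairsP[[v w] /= [vU wV ->]]].
- exact: frob_scalar0.
- by move=> x y; exact: frob_scalarD.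
- exact: frob_scalarZ.
- by apply: frob_scalarM => //; [apply: PU|apply: PV]; exact: vbasis_mem.
Qed.

Lemma elementary_nilp (E : finGroupScheme k) : elementary_abelian p E ->
  forall u : measures E, u 1 = 0 -> u ^+ p = 0.
Proof.
move=> elE u u0; have [c cE] := elementary_frob elE u.
have := congr1 (fun x : measures E => x 1) cE; rewrite meas_evalX u0.
rewrite expr0n -leqn0 leqNgt prime_gt0 // scale_lfunE meas_eval1.
by rewrite -[X in _ = X]/(_ * _) mulr1 cE => <-; rewrite scale0r.
Qed.

End FrobeniusMeasures.

Section LocalAlgebra.
Variables (k : fieldType) (E : finGroupScheme k) (p : nat).
Local Notation H := (measures E).
Local Notation I := (augmentation E).
Hypothesis HC : forall u v : H, u * v = v * u.
Hypothesis nilp : forall u : H, u 1 = 0 -> u ^+ p = 0.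
Implicit Types u v w : H.

Lemma unit_eval1 u : u 1 = 1 -> exists v, v * u = 1.
Proof.
move=> u1; pose n := 1 - u.
have n0 : n ^+ p = 0 by apply: nilp; rewrite /n add_lfunE opp_lfunE u1 meas_eval1 subrr.
exists (\sum_(i < p) n ^+ i); rewrite HC.
have := subrX1 n p; rewrite n0 sub0r => /eqP.
rewrite eqr_oppLR => /eqP ->; rewrite -mulNr opprB.
by congr (_ * _); rewrite /n opprB addrCA subrr addr0.
Qed.

Lemma Rad_augmentation : Rad H = I.
Proof.
have memI u : (u \in I) = (u 1 == 0) by exact: mem_augmentation.
have in_I u : u 1 = 0 -> u \in I by move/eqP; rewrite memI.
have Iideal : left_ideal I.
  by move=> a x; rewrite !memI meas_evalM => /eqP ->; rewrite mulr0.
have Imax : maximal_left_ideal I.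
  split=> // [|J Jl IJ].
    apply/eqP => If; have := memvf (1 : H); rewrite -If memI meas_eval1.
    by rewrite oner_eq0.
  have [JI|/subvPn[x xJ xI]] := boolP (J <= I)%VS; [left|right].
    by apply/eqP; rewrite eqEsubv JI.
  have x0 : x 1 != 0 by apply: contraNneq xI; exact: in_I.
  apply/eqP; rewrite eqEsubv subvf; apply/subvP => y _.
  have -> : y = (y 1 / x 1) *: x + (y - (y 1 / x 1) *: x) by rewrite addrC subrK.
  apply: memvD; first exact: memvZ.
  apply: (subvP IJ); apply: in_I; rewrite add_lfunE opp_lfunE scale_lfunE.
  by rewrite -[_ *: _]/(_ * _) divfK // subrr.
apply/eqP; rewrite eqEsubv; apply/andP; split; apply/subvP => x.
  by move/RadP => /(_ I); apply.
rewrite memI => /eqP x0; apply/RadP => J [Jl Jf Jmax]; apply/negPn/negP => xJ.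
pose K := (J + fullv * <[x]>)%VS.
have Kl : left_ideal K.
  move=> a _ /memv_addP[y yJ [_ /memv_cosetP[b _ ->] ->]].
  rewrite mulrDr memv_add ?Jl // mulrA; apply/memv_cosetP; exists (a * b) => //.
  exact: memvf.
have [KJ|Kf] := Jmax K Kl (addvSl _ _).
  move: xJ; rewrite -KJ -[X in X \notin _]add0r memv_add ?mem0v //.
  by apply/memv_cosetP; exists 1; rewrite ?memvf ?mul1r.
have : 1 \in K by rewrite Kf memvf.
move=> /memv_addP[y yJ [_ /memv_cosetP[b _ ->] yE]].
have [v vy] : exists v, v * y = 1.
  apply: unit_eval1; have -> : y = 1 - b * x by rewrite yE addrK.
  by rewrite add_lfunE opp_lfunE meas_evalM x0 mulr0 subr0 meas_eval1.
move: Jf => /eqP; apply; apply/eqP; rewrite eqEsubv subvf; apply/subvP => z _.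
by rewrite -[z]mulr1 -vy mulrA; exact: Jl.
Qed.

Lemma mem_Rad u : (u \in Rad H) = (u 1 == 0).
Proof. by rewrite Rad_augmentation mem_augmentation. Qed.

(* A proper subideal J of I of maximal dimension contains I^2: if x is in I but
   not in J then I = J + Hx, and J + Ix is a proper subideal of I, hence J. *)
Lemma Rad_sqr_proper : Rad H != 0%VS -> Rad H != (Rad H ^+ 2)%VS.
Proof.
rewrite Rad_augmentation => In0; apply/eqP => II.
pose Q n := `[< exists J : {vspace H},
  [/\ left_ideal J, (J <= I)%VS, J != I & \dim J = n] >].
have exQ : exists n, Q n.
  exists 0%N; apply/asboolP; exists 0%VS; split; rewrite ?sub0v ?dimv0 // 1?eq_sym //.
  by move=> a x; rewrite !memv0 => /eqP ->; rewrite mulr0.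
have leQ n : Q n -> (n <= \dim I)%N by move=> /asboolP[J [_ JI _ <-]]; exact: dimvS.
case: (ex_maxnP exQ leQ) => n /asboolP[J [Jl JI JnI dJ]] maxn.
have maxJ (K : {vspace H}) : left_ideal K -> (J <= K)%VS -> (K <= I)%VS ->
    K = I \/ K = J.
  move=> Kl JK KI; have [->|KnI] := eqVneq K I; [by left|right].
  have /maxn : Q (\dim K) by apply/asboolP; exists K.
  by rewrite -dJ => le; apply/esym/eqP; rewrite eqEdim JK.
have [x xI xJ] : exists2 x, x \in I & x \notin J.
  by apply/subvPn; apply: contra JnI => IJ; rewrite eqEsubv JI.
have ideal (U : {vspace H}) : left_ideal U -> left_ideal (J + U * <[x]>).
  move=> Ul a _ /memv_addP[y yJ [_ /memv_cosetP[b bU ->] ->]].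
  rewrite mulrDr memv_add ?Jl // mulrA; apply/memv_cosetP; exists (a * b) => //.
  exact: Ul.
have Il : left_ideal I.
  by move=> a y; rewrite !mem_augmentation meas_evalM => /eqP ->; rewrite mulr0.
have sub (U : {vspace H}) : (J + U * <[x]> <= I)%VS.
  rewrite subv_add JI; apply/subvP => _ /memv_cosetP[b _ ->].
  exact: Il.
have JIx : (J + I * <[x]> = J)%VS.
  have [eqI|//] := maxJ _ (ideal I Il) (addvSl _ _) (sub I).
  move: xI; rewrite -eqI => /memv_addP[y yJ [_ /memv_cosetP[b bI ->] xE]].
  have [v vb] : exists v, v * (1 - b) = 1.
    apply: unit_eval1; rewrite add_lfunE opp_lfunE meas_eval1.
    by move: bI; rewrite mem_augmentation => /eqP ->; rewrite subr0.
  have xvy : x = v * y.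
    by rewrite -[LHS]mul1r -vb -mulrA mulrBl mul1r {1}xE addrK.
  by case/negP: xJ; rewrite xvy Jl.
have JHx : (J + fullv * <[x]> = I)%VS.
  have Hl : left_ideal (fullv : {vspace H}) by move=> a y _; exact: memvf.
  have [//|eqJ] := maxJ _ (ideal fullv Hl) (addvSl _ _) (sub fullv).
  move: xJ; rewrite -eqJ -[X in X \notin _]add0r memv_add ?mem0v //.
  by apply/memv_cosetP; exists 1; rewrite ?memvf ?mul1r.
move: JnI; rewrite eqEsubv JI /= {1}II expv2 => /negP; apply.
apply/prodvP => a b aI; rewrite -[in X in X -> _]JHx.
move=> /memv_addP[y yJ [_ /memv_cosetP[c _ ->] ->]].
rewrite mulrDr; apply: memvD; first exact: Jl.
rewrite -JIx; apply: (subvP (addvSr _ _)).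
by rewrite mulrA; apply/memv_cosetP; exists (a * c) => //; rewrite HC Il.
Qed.

End LocalAlgebra.

(** * p-points *)

Lemma hockey_stick n i : (\sum_(b < n) 'C(b, i) = 'C(n, i.+1))%N.
Proof.
elim: n => [|n IH]; first by rewrite big_ord0 bin0n.
by rewrite big_ord_recr /= IH binS.
Qed.

Lemma natr_fact_neq0 (k : fieldType) p : p \in [pchar k] -> p.-1`!%:R != 0 :> k.
Proof.
move=> charkp; have p_prime := pcharf_prime charkp.
rewrite -(dvdn_pcharf charkp); apply/negP => dv.
have : (p %| (p.-1)`!.+1)%N by rewrite -Wilson // prime_gt1.
by rewrite -addn1 (dvdn_addr _ dv) dvdn1 => /eqP p1; rewrite p1 in p_prime.
Qed.

Section Weyl.
Variables (k : fieldType) (H : algType k) (u : H) (D : H -> H).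
Hypothesis D_linear : linear D.
Hypothesis Du : forall x, D (u * x) = x + u * D x.

Let DD x y : D (x + y) = D x + D y.
Proof. by have := D_linear 1 x y; rewrite !scale1r. Qed.

Let DMn x n : D (x *+ n) = D x *+ n.
Proof.
elim: n => [|n IH]; last by rewrite !mulrS DD IH.
by rewrite !mulr0n; apply: (addrI (D 0)); rewrite -DD !addr0.
Qed.

Lemma iter_derivation m x :
  iter m D (u * x) = u * iter m D x + iter m.-1 D x *+ m.
Proof.
elim: m => [|m IH]; first by rewrite addr0.
rewrite [LHS]iterS IH DD Du DMn [X in X + _]addrC -addrA mulrS; congr (_ + (_ + _)).
by case: m {IH}.
Qed.

Lemma iter_derivation_pow m n x :
  iter m D (u ^+ n * x) =
  \sum_(i < m.+1) (u ^+ (n - i) * iter (m - i) D x) *+ ('C(n, i) * m ^_ i).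
Proof.
elim: n m => [|n IH] m.
  rewrite big_ord_recl big1 => [|i _]; first by rewrite /= addr0 !subn0 !expr0 !mul1r.
  by rewrite bin0n mul0n mulr0n.
rewrite exprS -mulrA iter_derivation IH mulr_sumr.
have shift i : u * ((u ^+ (n - i) * iter (m - i) D x) *+ ('C(n, i) * m ^_ i))
    = (u ^+ (n.+1 - i) * iter (m - i) D x) *+ ('C(n, i) * m ^_ i).
  have [le_in|lt_ni] := leqP i n; last by rewrite bin_small // mul0n !mulr0n mulr0.
  by rewrite mulrnAr mulrA -exprS subSn.
under eq_bigr do rewrite shift.
rewrite !big_ord_recl /= !bin0 !subn0 -addrA; congr (_ + _).
case: m => [|m] in shift *; first by rewrite !big_ord0 mulr0n addr0.
rewrite IH -sumrMnl -big_split; apply: eq_bigr => i _ /=.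
rewrite /bump /= add1n !subSS -mulrnA -mulrnDr; congr (_ *+ _).
by rewrite ffactSS binS mulnDl; congr (_ + _)%N; rewrite -mulnA [(_ * m.+1)%N]mulnC.
Qed.

(* Since [D, u] = 1, moving D^(p-1) across u^b gives binomials 'C(b, i) whose
   sum over b < p is 'C(p, i.+1), and p divides all of these but the last. *)
Lemma higman_identity p x : p \in [pchar k] ->
  \sum_(b < p) u ^+ (p.-1 - b) * iter p.-1 D (u ^+ b * x) = x *+ p.-1`!.
Proof.
move=> charkp; have p_prime := pcharf_prime charkp.
have charH : p \in [pchar H] by rewrite pchar_lalg.
have pE : p.-1.+1 = p by rewrite prednK ?prime_gt0.
have termE (b : 'I_p) : u ^+ (p.-1 - b) * iter p.-1 D (u ^+ b * x)
    = \sum_(i < p.-1.+1) (u ^+ (p.-1 - i) * iter (p.-1 - i) D x) *+ ('C(b, i) * p.-1 ^_ i).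
  rewrite iter_derivation_pow mulr_sumr; apply: eq_bigr => i _.
  have [le_ib|lt_bi] := leqP i b; last by rewrite bin_small // mul0n !mulr0n mulr0.
  rewrite mulrnAr mulrA -exprD addnBA // subnK //.
  by rewrite -ltnS pE.
under eq_bigr do rewrite termE.
rewrite exchange_big /=.
rewrite big_ord_recr /= big1 ?add0r => [|i _].
  rewrite sumrMnr subnn expr0 mul1r -big_distrl /= hockey_stick pE binn mul1n.
  by rewrite ffactnn.
rewrite sumrMnr -big_distrl /= hockey_stick.
have [q ->] : exists q, 'C(p, i.+1) = (q * p)%N.
  by apply/dvdnP; rewrite prime_dvd_bin //= -[X in (_ < X)%N]pE ltnS.
by rewrite mulnAC mulrnA -mulr_natr (pcharf0 charH) mulr0.
Qed.

End Weyl.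

Section PPointTheory.
Variables (k : fieldType) (p : nat) (E : finGroupScheme k).
Local Notation H := (measures E).
Local Notation A := {poly %/ ('X^p : {poly k})}.
Local Notation t := (trunc_t k p).
Hypothesis charkp : p \in [pchar k].
Hypothesis HC : forall u v : H, u * v = v * u.
Hypothesis nilp : forall u : H, u 1 = 0 -> u ^+ p = 0.
Implicit Types u v w x : H.

Let p_prime : prime p := pcharf_prime charkp.
Let p_gt0 : (0 < p)%N := prime_gt0 p_prime.

Let mk_monicE : mk_monic ('X^p : {poly k}) = 'X^p.
Proof. by rewrite mk_monic_Xn prednK. Qed.

Lemma trunc_tX : t ^+ p = 0.
Proof.
rewrite -rmorphXn /=; apply/val_inj => /=.
by rewrite mk_monicE Pdiv.RingMonic.rmodpp ?monicXn.
Qed.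

Lemma trunc_ind (P : A -> Prop) : (forall c : k, P c%:A) ->
  (forall a b, P a -> P b -> P (a + b)) -> (forall a, P a -> P (a * t)) ->
  forall a, P a.
Proof.
move=> PC PD PX a; have -> : a = in_qpoly 'X^p (val a).
  by apply/val_inj; rewrite /= Pdiv.CommonRing.rmodp_small // size_mk_monic.
elim/poly_ind: (val a) => [|q c IH].
  by rewrite rmorph0 -(scale0r (1 : A)); exact: PC.
rewrite rmorphD rmorphM; apply: PD; first exact: PX.
suff : P (in_qpoly 'X^p c%:P) by [].
by rewrite -[c%:P]mulr1 mul_polyC in_qpolyZ in_qpoly1; exact: PC.
Qed.

Lemma primitive_of_Rad u : u \in Rad H -> u \notin (Rad H ^+ 2)%VS ->
  exists f : E, primitive_elt f /\ u f = 1.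
Proof.
have memR w : (w \in Rad H) = (w 1 == 0) by exact: (mem_Rad HC nilp).
rewrite memR => /eqP u0 uR2; pose W := (Rad H ^+ 2 + <[1%R]>)%VS.
have R2sub w : w \in (Rad H ^+ 2)%VS -> w 1 = 0.
  have : (Rad H ^+ 2 <= Rad H)%VS.
    by rewrite expv2; apply/prodvP => v v'; rewrite !memR meas_evalM => /eqP ->; rewrite mul0r.
  by move=> /subvP h /h; rewrite memR => /eqP.
have uW : u \notin W.
  apply: contra uR2 => /memv_addP[w wR [_ /vlineP[c ->] uE]].
  have := congr1 (fun x : H => x 1) uE.
  rewrite u0 add_lfunE (R2sub w wR) scale_lfunE meas_eval1 add0r -[RHS]/(_ * _) mulr1.
  by move=> c0; rewrite uE -c0 scale0r addr0.
have [F [FW Fu]] := separating_form uW; have [f fF] := reflexive F.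
exists f; split; last by rewrite -fF.
apply: primitive_eltP => v w; rewrite -!fF.
pose red (x : H) : H := x - (x 1 : k) *: (1 : H).
have split (x : H) : x = (x 1 : k) *: (1 : H) + red x by rewrite addrC subrK.
have rad (x : H) : red x \in Rad H.
  by rewrite memR add_lfunE opp_lfunE scale_lfunE meas_eval1 -[_ *: _]/(_ * _) mulr1 subrr.
clearbody red.
have F1 : F 1 = 0 by apply: FW; apply: (subvP (addvSr _ _)); exact: memv_line.
have FR2 x y : x \in Rad H -> y \in Rad H -> F (x * y) = 0.
  move=> xR yR; apply: FW; apply: (subvP (addvSl _ _)).
  by rewrite expv2; exact: memv_mul.
have Fred x : F x = F (red x) by rewrite {1}(split x) linearD linearZ /= F1 scaler0 add0r.
have vwE : v * w = (v 1 * w 1 : k) *: (1 : H) + (v 1 : k) *: red w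
    + ((w 1 : k) *: red v + red v * red w).
  rewrite [in LHS](split v) [in LHS](split w) mulrDl !mulrDr.
  by rewrite -!scalerAl -!scalerAr !mul1r mulr1 scalerA.
rewrite vwE !linearD /= !linearZ /= F1 scaler0 add0r FR2 // addr0 -!Fred addrC.
by congr (_ + _); rewrite -[LHS]/(_ * _) mulrC.
Qed.

Lemma projective_criterion (alpha : {rmorphism A -> H}) (theta : H -> H) :
  linear theta -> (forall c : k, alpha c%:A = c%:A) ->
  (forall x, \sum_(b < p) alpha t ^+ (p.-1 - b) * theta (alpha t ^+ b * x) = x) ->
  projective (restr alpha).
Proof.
move=> lth alphaC thE N N' g h gsurj; set u := alpha t.
have /choice[s sP] : forall x : H, exists y, g y = h x by move=> x; exact: gsurj.
pose sig (x : H) : N :=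
  \sum_(i < \dim {:H}) (coord (vbasis {:H}) i x)%:A *: s (vbasis {:H})`_i.
have sigD x y : sig (x + y) = sig x + sig y.
  rewrite /sig -big_split; apply: eq_bigr => i _.
  by rewrite linearD /= scalerDl scalerDl.
have sigZ c x : sig (c *: x) = (c%:A : A) *: sig x.
  rewrite /sig scaler_sumr; apply: eq_bigr => i _.
  by rewrite linearZ /= scalerA -scalerAl mul1r scalerA.
have hact a x : h (alpha a * x) = a *: h x.
  by have := linearZ_LR h a x.
have gsig x : g (sig x) = h x.
  rewrite linear_sum [in RHS](coord_vbasis (memvf x)) linear_sum.
  apply: eq_bigr => i _; rewrite linearZ /= sP.
  by rewrite -hact alphaC -scalerAl mul1r.
pose h' (x : restr alpha) : N :=
  \sum_(b < p) t ^+ (p.-1 - b) *: sig (theta (u ^+ b * x)).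
have thD x y : theta (x + y) = theta x + theta y.
  by have := lth 1 x y; rewrite !scale1r.
have th0 : theta 0 = 0 by apply: (addrI (theta 0)); rewrite -thD !addr0.
have thZ c x : theta (c *: x) = c *: theta x.
  by have := lth c x 0; rewrite th0 !addr0.
have sig0 : sig 0 = 0 by apply: (addrI (sig 0)); rewrite -sigD !addr0.
have h'D x y : h' (x + y) = h' x + h' y.
  rewrite /h' -big_split; apply: eq_bigr => b _.
  by rewrite mulrDr thD sigD scalerDr.
have tele n (F : nat -> N) : t ^+ n.+1 *: F 0 = 0 -> F n.+1 = 0 ->
    \sum_(b < n.+1) t ^+ (n - b) *: F b.+1
    = \sum_(b < n.+1) t *: (t ^+ (n - b) *: F b).
  move=> F0 Fn; rewrite big_ord_recr big_ord_recl /= Fn scaler0 addr0.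
  rewrite subn0 scalerA -exprS F0 add0r; apply: eq_bigr => b _.
  by rewrite /bump /= add1n scalerA -exprS -subSn ?ltn_ord // subSS.
have sumE (F : nat -> N) : \sum_(b < p) F b = \sum_(b < p.-1.+1) F b.
  by rewrite prednK.
have h't x : h' (u * x) = t *: h' x.
  rewrite /h' scaler_sumr.
  rewrite (sumE (fun b => t ^+ (p.-1 - b) *: sig (theta (u ^+ b * (u * x))))).
  rewrite (sumE (fun b => t *: (t ^+ (p.-1 - b) *: sig (theta (u ^+ b * x))))).
  rewrite -(tele _ (fun b => sig (theta (u ^+ b * x)))).
  - by apply: eq_bigr => b _; rewrite mulrA -exprSr.
  - by rewrite prednK // trunc_tX scale0r.
  - by rewrite prednK // -rmorphXn trunc_tX rmorph0 mul0r th0.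
have h'lin : linear h'.
  move=> a x y; rewrite h'D; congr (_ + _).
  rewrite -[a *: x]/(alpha a * (x : H)).
  elim/trunc_ind: a x => [c x|a b IHa IHb x|a IH x].
  - rewrite alphaC -scalerAl mul1r /h' scaler_sumr; apply: eq_bigr => b _.
    by rewrite -scalerAr thZ sigZ !scalerA mulrC.
  - by rewrite rmorphD mulrDl h'D IHa IHb scalerDl.
  - by rewrite rmorphM -mulrA IH h't scalerA.
pose h'' : {linear restr alpha -> N} :=
  HB.pack h' (GRing.isLinear.Build A (restr alpha) N _ h' h'lin).
exists h'' => x; rewrite -[h'' x]/(h' x) /h' linear_sum -[in RHS](thE x) linear_sum.
apply: eq_bigr => b _; rewrite linearZ /= gsig -hact.
by rewrite rmorphXn.
Qed.

End PPointTheory.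

Section PPointExistence.
Variables (k : fieldType) (p : nat) (E : finGroupScheme k).
Local Notation H := (measures E).
Local Notation A := {poly %/ ('X^p : {poly k})}.
Local Notation t := (trunc_t k p).
Hypothesis charkp : p \in [pchar k].
Hypothesis HC : forall u v : H, u * v = v * u.
Hypothesis nilp : forall u : H, u 1 = 0 -> u ^+ p = 0.
Implicit Types u v w x : H.

Let p_prime : prime p := pcharf_prime charkp.
Let p_gt0 : (0 < p)%N := prime_gt0 p_prime.

Lemma trunc_lift u : u ^+ p = 0 ->
  exists alpha : {lrmorphism A -> H}, alpha t = u.
Proof.
move=> up; pose f (q : A) : H := horner_alg u (val q).
have mkE : mk_monic ('X^p : {poly k}) = 'X^p by rewrite mk_monic_Xn prednK.
have f_in q : f (in_qpoly 'X^p q) = horner_alg u q.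
  rewrite /f /= mkE [in RHS](Pdiv.RingMonic.rdivp_eq (monicXn k p) q).
  by rewrite rmorphD rmorphM rmorphXn /= horner_algX up mulr0 add0r.
have lf : linear f.
  move=> c a b; rewrite /f -[val _]/(c *: (val a : {poly k}) + val b).
  by rewrite linearD linearZ /= mulr_algl.
have mf : monoid_morphism f.
  split=> [|a b]; first by rewrite /f /= rmorph1.
  by rewrite -[a * b]/(in_qpoly 'X^p ((val a : {poly k}) * val b)) f_in rmorphM.
pose F : {lrmorphism A -> H} := HB.pack f (GRing.isLinear.Build k A H _ f lf)
   (GRing.isMonoidMorphism.Build A H f mf).
by exists F; rewrite -[F t]/(f t) f_in horner_algX.
Qed.

Lemma ppoint_exists u : u \in Rad H -> u \notin (Rad H ^+ 2)%VS ->
  exists alpha : pPoint p E, alpha t = u.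
Proof.
move=> uR uR2; have [f [fp uf]] := primitive_of_Rad HC nilp uR uR2.
have up : u ^+ p = 0.
  by apply: nilp; apply/eqP; rewrite -(mem_Rad HC nilp).
have [alpha alphat] := trunc_lift up.
have [y yD] : exists y, y * contract f u = 1.
  by apply: (unit_eval1 HC nilp); rewrite contractE mulr1.
pose D x := y * contract f x.
have lD : linear D.
  move=> c a b; rewrite /D contractD mulrDr scalerAr; congr (_ * _ + _).
  by apply/lfunP => g; rewrite scale_lfunE !contractE scale_lfunE.
have Du x : D (u * x) = x + u * D x.
  by rewrite /D contractM // mulrDr mulrA yD mul1r mulrA [y * u]HC -mulrA.
pose c : k := (p.-1`!)%:R^-1.
have lth : linear (fun x => c *: iter p.-1 D x).
  have li m : linear (iter m D) by elim: m => [|m IH] a x z //=; rewrite IH lD.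
  by move=> a x z; rewrite li scalerDr !scalerA mulrC.
have pr : projective (restr alpha).
  apply: (projective_criterion charkp lth) => [a|x].
    exact: rmorph_alg.
  rewrite (alphat : (alpha : {rmorphism A -> H}) t = u) -[RHS]scale1r.
  rewrite -(mulVf (natr_fact_neq0 charkp)) -scalerA scaler_nat.
  rewrite -(higman_identity lD Du x charkp) scaler_sumr.
  by apply: eq_bigr => b _; rewrite scalerAr.
by exists (PPoint pr).
Qed.

End PPointExistence.

Section Antipode.
Variables (k : fieldType) (p : nat) (E : finGroupScheme k).
Local Notation H := (measures E).
Local Notation A := {poly %/ ('X^p : {poly k})}.
Local Notation S := (@antipode k E).
Hypothesis abE : abelian_scheme E.

Let HC : forall u v : H, u * v = v * u := meas_mulC abE.

Lemma counit_antipode (x : E) : counit (S x) = counit x.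
Proof.
have /lfunP/(_ x) := meas_antipode1 E.
by rewrite comp_lfunE.
Qed.

Lemma antipode_antipode (x : E) :
  tlift (fun a b => S a * S (S b)) (comul x) = (counit x)%:A.
Proof.
rewrite -counit_antipode -antipodel antipode_comul (tlift_comp _ _ (tlift_linear _)).
apply: eq_tlift => a b; rewrite tlift_tpure; first exact: coord_ringC.
by apply: (bilin_comp (mul_bilin E)); [exact: hom_linear|exact: id_linear].
Qed.

Lemma antipodeK : involutive S.
Proof.
have [L R] := mul_bilin E; have lS : linear S := hom_linear S.
have lSS : linear (fun b : E => S (S b)) by exact: comp_linear.
move=> x; rewrite -[in LHS](counitl x) (tlift_comp _ _ lSS).
transitivity (tlift (fun a b => tlift (fun c d => c * S d) (comul a) * S (S b)) (comul x)).
  by apply: eq_tlift => a b; rewrite antipoder (linZ _ _ lSS) -scalerAl mul1r.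
transitivity (tlift (fun a b => tlift (fun c d => c * (S d * S (S b))) (comul a)) (comul x)).
  apply: eq_tlift => a b; rewrite (tlift_comp _ _ (R (S (S b)))).
  by apply: eq_tlift => c d; rewrite mulrA.
rewrite -(coassoc (T := fun c d b => c * (S d * S (S b)))); first last.
- by move=> a b; apply: (comp_linear (L _)); apply: (comp_linear (L _)).
- by move=> a c; apply: (comp_linear (L _)); apply: (comp_linear (R _)).
- by move=> b c; exact: R.
rewrite -[in RHS](counitr x); apply: eq_tlift => a b.
rewrite -(tlift_comp _ _ (L a)) antipode_antipode.
by rewrite -scalerAr mulr1.
Qed.

Lemma meas_antipodeK : involutive (@meas_antipode k E).
Proof. by move=> u; apply/lfunP => f; rewrite !comp_lfunE /= antipodeK. Qed.

Lemma meas_antipodeD (u v : H) :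
  meas_antipode (u + v) = meas_antipode u + meas_antipode v.
Proof. by have := meas_antipode_linear 1 u v; rewrite !scale1r. Qed.

Lemma ppoint_antipode (alpha : pPoint p E) :
  exists beta : pPoint p E, forall q, beta q = meas_antipode (alpha q).
Proof.
pose f (q : A) := meas_antipode (alpha q).
have lf : linear f by move=> c a b; rewrite /f linearP meas_antipode_linear.
have mf : monoid_morphism f.
  split=> [|a b]; first by rewrite /f rmorph1 meas_antipode1.
  by rewrite /f rmorphM meas_antipodeM HC.
pose F : {lrmorphism A -> H} := HB.pack f (GRing.isLinear.Build k A H _ f lf)
   (GRing.isMonoidMorphism.Build A H f mf).
suff pr : projective (restr F) by exists (PPoint pr).
move=> N N' g h gsurj.
pose h1 (x : restr alpha) : N' := h (meas_antipode (x : H)).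
have lh1 : linear h1.
  move=> a x y; rewrite /h1 -[a *: x]/(alpha a * (x : H)).
  rewrite meas_antipodeD meas_antipodeM HC.
  exact: (linearP h a (meas_antipode (x : H)) (meas_antipode (y : H))).
pose h1' : {linear restr alpha -> N'} :=
  HB.pack h1 (GRing.isLinear.Build A (restr alpha) N' _ h1 lh1).
have [h2 h2P] := @ppt_proj _ _ _ alpha N N' g h1' gsurj.
pose h3 (x : restr F) : N := h2 (meas_antipode (x : H)).
have lh3 : linear h3.
  move=> a x y; rewrite /h3 -[a *: x]/(f a * (x : H)).
  rewrite meas_antipodeD meas_antipodeM HC /f meas_antipodeK.
  exact: (linearP h2 a (meas_antipode (x : H)) (meas_antipode (y : H))).
exists (HB.pack h3 (GRing.isLinear.Build A (restr F) N _ h3 lh3) : {linear restr F -> N}).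
move=> x; rewrite /= /h3 h2P -[h1' _]/(h1 _) /h1.
by congr (h _); exact: meas_antipodeK.
Qed.

Lemma antipode_augmentation (u : H) : (meas_antipode u) 1 = u 1.
Proof.
rewrite comp_lfunE /=; congr (u _); have := antipodel (1 : E).
rewrite comul1 tlift_tpure ?mulr1 ?counit1 ?scale1r //.
by apply: (bilin_comp (mul_bilin E)); [exact: hom_linear|exact: id_linear].
Qed.

Lemma antipode_Rad2 (u : H) : (forall u : H, u 1 = 0 -> u ^+ p = 0) ->
  (meas_antipode u \in (Rad H ^+ 2)%VS) = (u \in (Rad H ^+ 2)%VS).
Proof.
move=> nilp; have memR (w : H) : (w \in Rad H) = (w 1 == 0) by exact: (mem_Rad HC nilp).
suff sub (v : H) : v \in (Rad H ^+ 2)%VS -> meas_antipode v \in (Rad H ^+ 2)%VS.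
  by apply/idP/idP => [/sub|/sub //]; rewrite meas_antipodeK.
pose T : 'End(H) := linfun (@meas_antipode k E).
have TE w : T w = meas_antipode w by rewrite linfunE //; exact: meas_antipode_linear.
have : (Rad H ^+ 2 <= T @^-1: (Rad H ^+ 2))%VS.
  rewrite {1}expv2; apply/prodvP => a b aR bR.
  rewrite -memv_preim TE meas_antipodeM expv2 memv_mul //.
    by rewrite memR antipode_augmentation -memR.
  by rewrite memR antipode_augmentation -memR.
by move=> /subvP h /h; rewrite -memv_preim TE.
Qed.

End Antipode.

(** * Ranks of the dual module *)

Lemma dim_dual (k : fieldType) (M : vectType k) :
  \dim {:'Hom(M, k^o)} = \dim {:M}.
Proof. by rewrite !dimvf; exact: muln1. Qed.

Lemma rank_precomp (k : fieldType) (M : vectType k) (T : 'End(M))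
    (T' : 'End('Hom(M, k^o))) :
  (forall phi, T' phi = (phi \o T)%VF) -> \dim (limg T') = \dim (limg T).
Proof.
move=> T'E; pose W := limg T.
pose psi (a : 'I_(\dim W)) : 'Hom(M, k^o) := linfun (coord (vbasis W) a : M -> k^o).
have psiE a v : psi a v = coord (vbasis W) a v by rewrite lfunE.
pose X := [tuple (psi a \o T)%VF | a < \dim W].
have XE (a : 'I_(\dim W)) : X`_a = (psi a \o T)%VF by rewrite -tnth_nth tnth_mktuple.
apply/eqP; rewrite eqn_leq; apply/andP; split.
  apply: (@leq_trans (\dim <<X>>)); last by rewrite (leq_trans (dim_span _)) // size_tuple.
  apply: dimvS; apply/subvP => _ /memv_imgP[phi _ ->]; rewrite T'E.
  have -> : (phi \o T)%VF = \sum_(a < \dim W) phi (vbasis W)`_a *: X`_a.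
    apply/lfunP => v; rewrite comp_lfunE sum_lfunE.
    have TvW : T v \in W by rewrite memv_img ?memvf.
    rewrite {1}(coord_vbasis TvW) linear_sum /=; apply: eq_bigr => a _.
    rewrite linearZ scale_lfunE XE comp_lfunE psiE /=.
    by rewrite -[LHS]/(_ * _) mulrC.
  by apply: memv_suml => a _; rewrite memvZ // memv_span // mem_nth // size_tuple.
have freeX : free X.
  apply/freeP => c cX a; have : (vbasis W)`_a \in W.
    by rewrite vbasis_mem // mem_nth // size_tuple.
  case/memv_imgP => v _ vE; have := congr1 (fun phi : 'Hom(M, k^o) => phi v) cX.
  rewrite sum_lfunE (bigD1 a) //= big1 => [|b ba].
    rewrite addr0 scale_lfunE XE comp_lfunE -vE psiE coord_free ?(basis_free (vbasisP W)) //.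
    by rewrite eqxx zero_lfunE -[LHS]/(_ * _) mulr1.
  rewrite scale_lfunE XE comp_lfunE -vE psiE coord_free ?(basis_free (vbasisP W)) //.
  by rewrite eq_sym (negPf ba) scaler0.
have <- : size X = \dim W by rewrite size_tuple.
rewrite -(eqP freeX); apply: dimvS; apply/span_subvP => _ /mapP[a _ ->].
by rewrite -T'E memv_img ?memvf.
Qed.

Section Ranks.
Variables (k : fieldType) (p : nat) (E : finGroupScheme k).
Local Notation H := (measures E).
Local Notation t := (trunc_t k p).
Hypothesis abE : abelian_scheme E.
Variables (M : eModule E) (j : nat).
Implicit Types u : H.

Lemma op_powSr (N : eModule E) u i : op_pow N u i.+1 = (op_pow N u i \o op N u)%VF.
Proof.
elim: i => [|i IH]; first by rewrite /op_pow /= comp_lfun1l comp_lfun1r.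
by rewrite -[LHS]/(op N u \o op_pow N u i.+1)%VF [X in (_ \o X)%VF = _]IH comp_lfunA.
Qed.

Lemma dual_op_pow u i (phi : 'Hom(M, k^o)) :
  op_pow (dual_module M) u i phi = (phi \o op_pow M (meas_antipode u) i)%VF.
Proof.
elim: i => [|i IH]; first by rewrite /op_pow /= id_lfunE comp_lfun1r.
rewrite -[op_pow _ u i.+1]/(op (dual_module M) u \o op_pow (dual_module M) u i)%VF.
rewrite comp_lfunE [X in op _ _ X]IH op_powSr.
rewrite -[LHS]/(dual_op M u (phi \o op_pow M (meas_antipode u) i)%VF).
by rewrite dual_opE comp_lfunA.
Qed.

Lemma dual_rank u : \dim (limg (op_pow (dual_module M) u j))
  = \dim (limg (op_pow M (meas_antipode u) j)).
Proof. by apply: rank_precomp => phi; exact: dual_op_pow. Qed.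

Lemma dual_max_rank : max_rank p (dual_module M) j = max_rank p M j.
Proof.
rewrite /max_rank.
have -> : \dim {:dual_module M} = \dim {:M} by exact: dim_dual.
apply: eq_bigl => r; apply/asboolP/asboolP => -[alpha <-];
  have [beta betaE] := ppoint_antipode abE alpha; exists beta.
  by rewrite /ppt_rank betaE dual_rank.
by rewrite /ppt_rank dual_rank betaE meas_antipodeK.
Qed.

Hypothesis charkp : p \in [pchar k].
Hypothesis nilp : forall u : H, u 1 = 0 -> u ^+ p = 0.
Hypothesis j_gt0 : (0 < j)%N.
Hypothesis crM : constant_rank p M j.

Let HC : forall u v : H, u * v = v * u := meas_mulC abE.

Lemma rank_const u : u \in Rad H -> u \notin (Rad H ^+ 2)%VS ->
  \dim (limg (op_pow M u j)) = max_rank p M j.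
Proof.
by move=> uR uR2; have [alpha <-] := ppoint_exists charkp HC nilp uR uR2; exact: crM.
Qed.

Lemma Rad_neq0 : (0 < max_rank p M j)%N -> Rad H != 0%VS.
Proof.
move=> d_gt0; have [alpha rk] : exists alpha : pPoint p E, ppt_rank M j alpha = max_rank p M j.
  apply: contrapT => no; move: d_gt0; rewrite /max_rank big_pred0 // => r.
  by apply/asboolP => -[alpha _]; apply: no; exists alpha; exact: crM.
apply: contraTneq d_gt0 => R0; rewrite -rk /ppt_rank.
have -> : alpha t = 0.
  apply/eqP; rewrite -memv0 -R0 (mem_Rad HC nilp).
  have : (alpha t) ^+ p = 0 by rewrite -rmorphXn trunc_tX // rmorph0.
  move/(congr1 (fun u : H => u 1)); rewrite meas_evalX zero_lfunE => /eqP.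
  by rewrite expf_eq0 => /andP[].
have -> : op_pow M 0 j = 0.
  case: (j) j_gt0 => // i _; rewrite -[op_pow M 0 i.+1]/(op M 0 \o op_pow M 0 i)%VF.
  by apply/lfunP => x; rewrite comp_lfunE linear0 !zero_lfunE.
have -> : limg (0 : 'End(M)) = 0%VS.
  apply/eqP; rewrite -subv0; apply/subvP => _ /memv_imgP[x _ ->].
  by rewrite zero_lfunE mem0v.
by rewrite dimv0.
Qed.

Lemma Rad_plane : (0 < max_rank p M j)%N ->
  (\dim (Rad H) - \dim (Rad H ^+ 2))%N <> 1%N ->
  exists u v, [/\ u \in Rad H, v \in Rad H &
    forall s t : k, (s, t) != (0, 0) -> s *: u + t *: v \notin (Rad H ^+ 2)%VS].
Proof.
move=> /Rad_neq0 Rn0 cod.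
have memR w : (w \in Rad H) = (w 1 == 0) by exact: (mem_Rad HC nilp).
have R2R : (Rad H ^+ 2 <= Rad H)%VS.
  by rewrite expv2; apply/prodvP => v v'; rewrite !memR meas_evalM => /eqP ->; rewrite mul0r.
have := Rad_sqr_proper HC nilp Rn0; rewrite eqEsubv R2R andbT.
case/subvPn => u uR uR2; pose K := (Rad H ^+ 2 + <[u]>)%VS.
have dK : (\dim K <= (\dim (Rad H ^+ 2)).+1)%N.
  rewrite (leq_trans (dimv_add_leqif _ _)) // dim_vline addnC.
  by case: (u != 0); rewrite ?leqnn // ltnW.
have dR : ((\dim (Rad H ^+ 2)).+1 < \dim (Rad H))%N.
  have lt : (\dim (Rad H ^+ 2) < \dim (Rad H))%N.
    rewrite ltn_neqAle dimvS // andbT; apply: contra uR2 => /eqP dE.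
    have : (Rad H ^+ 2)%VS == Rad H by rewrite eqEdim R2R dE /=.
    by move/eqP ->.
  rewrite ltn_neqAle lt andbT; apply/eqP => dE; apply: cod.
  by rewrite -dE subSnn.
have /subvPn[v vR vK] : ~~ (Rad H <= K)%VS.
  by apply/negP => /dimvS; rewrite leqNgt (leq_ltn_trans dK dR).
exists u, v; split=> // s c; have [->|c0] := eqVneq c 0.
  rewrite xpair_eqE eqxx andbT => s0; rewrite scale0r addr0.
  apply: contra uR2 => su; rewrite -[u]scale1r -(mulVf s0) -scalerA.
  exact: memvZ.
move=> _; apply: contra vK => suv.
have -> : v = c^-1 *: ((s *: u + c *: v) - s *: u).
  by rewrite addrC addKr scalerA mulVf // scale1r.
apply: memvZ; apply: memvB; first exact: (subvP (addvSl _ _)).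
by apply: (subvP (addvSr _ _)); rewrite memvZ // memv_line.
Qed.

End Ranks.

(** * Degrees *)

Lemma minor_tr (R : comNzRingType) d m1 m2 (X : 'M[R]_(m1, m2))
    (I : incr_map d m1) (J : incr_map d m2) : minor X^T J I = minor X I J.
Proof.
by rewrite /minor -det_tr; congr (\det _); apply/matrixP => a b; rewrite !mxE.
Qed.

Lemma minor_homog (k : closedFieldType) n d e m1 m2 (X : 'M[{mpoly k[n]}]_(m1, m2))
    (I : incr_map d m1) (J : incr_map d m2) :
  (forall a b, X a b \is e.-homog) -> minor X I J \is (d * e).-homog.
Proof.
move=> Xh; rewrite /minor /determinant; apply: rpred_sum => s _.
have h (f : 'I_d -> 'I_d) :
    \prod_(i < d) mxsub (val I) (val J) X i (f i) \is (d * e).-homog.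
  rewrite -[X in (X * e)%N]card_ord -sum_nat_const.
  by apply: prod_homog => i; rewrite mxE.
by case: (perm.odd_perm s); rewrite ?expr1 ?expr0 ?mul1r ?mulN1r ?rpredN; exact: h.
Qed.

Section Coordinates.
Variables (k : closedFieldType) (V : vectType k) (R : {vspace V}).
Local Notation n := (\dim R).

Definition rcoord (v : V) : 'I_n -> k := fun l => coord (vbasis R) l v.
Definition rvec (x : 'I_n -> k) : V := \sum_(l < n) x l *: (vbasis R)`_l.

Lemma rvec_mem x : rvec x \in R.
Proof.
by apply: memv_suml => l _; rewrite memvZ // vbasis_mem // mem_nth // size_tuple.
Qed.

Lemma rcoordK v : v \in R -> rvec (rcoord v) = v.
Proof. by move=> vR; rewrite [RHS](coord_vbasis vR). Qed.

Lemma rvecK x : rcoord (rvec x) =1 x.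
Proof. by move=> l; rewrite /rcoord coord_sum_free ?(basis_free (vbasisP R)). Qed.

Lemma rcoordP a u b v l : rcoord (a *: u + b *: v) l = a * rcoord u l + b * rcoord v l.
Proof. by rewrite /rcoord linearD /= !linearZ. Qed.

Definition form_poly (F : V -> k) : {mpoly k[n]} :=
  \sum_(l < n) F (vbasis R)`_l *: 'X_l.

Lemma form_poly_homog F : form_poly F \is 1.-homog.
Proof.
have Xh (l : 'I_n) : ('X_l : {mpoly k[n]}) \is 1.-homog by rewrite dhomogX /= mdeg1.
by apply: rpred_sum => l _; apply: rpredZ; exact: Xh.
Qed.

Lemma form_polyE (F : 'Hom(V, k^o)) x : (form_poly F).@[x] = F (rvec x).
Proof.
rewrite /form_poly /rvec linear_sum raddf_sum /=; apply: eq_bigr => l _.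
by rewrite mevalZ mevalXU linearZ mulrC.
Qed.

End Coordinates.

Arguments rcoord {k V} R v _.

Section OperatorMatrix.
Variables (k : closedFieldType) (E : finGroupScheme k) (M : eModule E).
Variables (m : nat) (vs : 'I_m -> M).
Local Notation H := (measures E).
Local Notation n := (\dim (Rad H)).
Local Notation e := (vbasis {:M}).

Definition op_coord (i i' : 'I_(\dim {:M})) : 'Hom(H, k^o) :=
  linfun (fun u : H => coord e i' (op M u e`_i) : k^o).

Lemma op_coordE i i' u : op_coord i i' u = coord e i' (op M u e`_i).
Proof.
by rewrite linfunE // => a x y; rewrite linearP add_lfunE scale_lfunE linearP.
Qed.

Definition op_mx : 'M[{mpoly k[n]}]_(\dim {:M}) :=
  \matrix_(i, i') form_poly (Rad H) (op_coord i i').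

Fixpoint op_pow_mx (j : nat) : 'M[{mpoly k[n]}]_(m, \dim {:M}) :=
  if j is i.+1 then op_pow_mx i *m op_mx
  else \matrix_(l, i) (coord e i (vs l))%:MP.

Lemma op_pow_mx_homog j l i : op_pow_mx j l i \is j.-homog.
Proof.
elim: j i => [|j IH] i /=.
  by rewrite mxE -[_%:MP]mulr1 mul_mpolyC rpredZ // dhomog1.
rewrite mxE; apply: rpred_sum => i' _; rewrite -addn1; apply: dhomogM => //.
by rewrite mxE form_poly_homog.
Qed.

Lemma op_pow_mx_eval j x : map_mx (meval x) (op_pow_mx j)
  = \matrix_(l, i) coord e i (op_pow M (rvec x) j (vs l)).
Proof.
elim: j => [|j IH].
  by apply/matrixP => l i; rewrite !mxE mevalC /op_pow /= id_lfunE.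
rewrite /= map_mxM IH; apply/matrixP => l i; rewrite !mxE.
rewrite comp_lfunE [in RHS](coord_vbasis (memvf (op_pow M (rvec x) j (vs l)))).
set T := op M (rvec x); rewrite !linear_sum /=; apply: eq_bigr => i' _.
by rewrite !mxE form_polyE op_coordE !linearZ.
Qed.

End OperatorMatrix.

Section Degree.
Variables (k : closedFieldType) (E : finGroupScheme k).
Local Notation H := (measures E).
Local Notation R := (Rad H).
Local Notation n := (\dim R).
Variables (u0 : H) (u0R : u0 \in R) (u0R2 : u0 \notin (R ^+ 2)%VS).

Lemma U_E_line u : u \in R -> u \notin (R ^+ 2)%VS -> U_E <[u]>%VS.
Proof.
move=> uR uR2; split; rewrite -?memvE // dim_vline.
by case: eqP uR2 => // ->; rewrite mem0v.
Qed.

Lemma vpick_U_E (L : {vspace H}) : U_E L ->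
  vpick L \in R /\ vpick L \notin (R ^+ 2)%VS.
Proof.
move=> [dL LR LR2]; split; first by apply: (subvP LR); exact: memv_pick.
apply: contra LR2 => pR2; suff -> : L = <[vpick L]>%VS by rewrite -memvE.
apply/eqP; rewrite eq_sym eqEdim -memvE memv_pick dL dim_vline vpick0.
by rewrite -dimv_eq0 dL.
Qed.

Lemma Rad_dense (p q : {mpoly k[n]}) :
  (forall x, rvec (R := R) x \notin (R ^+ 2)%VS -> p.@[x] = q.@[x]) -> p = q.
Proof.
have [F [FR2 Fu]] := separating_form u0R2.
move=> pq; apply: (@mpoly_ext_dense _ _ (form_poly R F)).
  apply/eqP => F0; have := form_polyE (R := R) F (rcoord R u0).
  by rewrite F0 meval0 rcoordK // Fu => /esym/eqP; rewrite oner_eq0.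
move=> x; rewrite form_polyE => Fx; apply: pq.
by apply: contraNN Fx => /FR2 ->.
Qed.

Lemma degree_unique (I : finType) (phi : {vspace H} -> {vspace {ffun I -> k^o}}) e :
  has_degree R (@U_E k E) phi e -> (forall L, U_E L -> phi L != 0%VS) ->
  degree R (@U_E k E) phi = e.
Proof.
move=> dege phi0; apply: classical_sets.xget_unique => // e' dege'.
have [f [fh fc fphi]] := dege; have [f' [fh' fc' fphi']] := dege'.
pose ev (g : I -> {mpoly k[n]}) L : {ffun I -> k^o} :=
  [ffun i => (g i).@[rcoord R (vpick L)] : k^o].
have evE L : U_E L -> exists2 c : k, c != 0 & ev f L = c *: ev f' L.
  move=> UL; have := memv_line (ev f L); rewrite -(fphi L UL) (fphi' L UL).
  case/vlineP => c cE; exists c => //; apply: contraNneq (phi0 L UL) => c0.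
  rewrite (fphi L UL) -[X in <[X]>%VS]/(ev f L) cE c0 scale0r.
  by rewrite -subv0 -memvE mem0v.
have UL0 : U_E <[u0]>%VS by exact: U_E_line.
have [i fi] : exists i, ev f <[u0]>%VS i != 0.
  apply/existsP; rewrite -negb_forall; apply: contra (phi0 _ UL0) => /forallP z.
  rewrite (fphi _ UL0) -[X in <[X]>%VS]/(ev f <[u0]>%VS) -subv0 -memvE.
  rewrite (_ : ev f _ = 0) ?mem0v //; apply/ffunP => i.
  by rewrite (eqP (z i)) ffunE.
have fi' : ev f' <[u0]>%VS i != 0.
  have [c _ cE] := evE _ UL0; move: fi; rewrite cE ffunE.
  by apply: contra_neq => ->; rewrite scaler0.
have prop (i1 i2 : I) : f i1 * f' i2 = f i2 * f' i1.
  apply: Rad_dense => x xR2; set u := rvec x in xR2.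
  have uR : u \in R by exact: rvec_mem.
  have UL := U_E_line uR xR2.
  have /vlineP[c cE] := memv_pick <[u]>%VS.
  have c0 : c != 0.
    apply: contraTneq xR2 => c0; move: cE; rewrite c0 scale0r => /eqP.
    by rewrite vpick0 -subv0 -memvE memv0 => /eqP ->; rewrite mem0v.
  have coE : rcoord R (vpick <[u]>%VS) =1 (fun l => c * x l).
    by move=> l; rewrite cE /rcoord linearZ -[X in _ = c * X](rvecK x l).
  have [a _ aE] := evE _ UL.
  have fE i' : (f i').@[rcoord R (vpick <[u]>%VS)] = a * (f' i').@[rcoord R (vpick <[u]>%VS)].
    by have := congr1 (fun s : {ffun I -> k^o} => s i') aE; rewrite !ffunE.
  have ce0 : c ^+ (e + e') != 0 by rewrite expf_neq0.
  apply: (mulfI ce0); rewrite -!meval_homog ?dhomogM // -!(meval_eq _ coE) !mevalM !fE.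
  by rewrite -!mulrA; congr (_ * _); rewrite mulrC.
have ne0 (g : I -> {mpoly k[n]}) : ev g <[u0]>%VS i != 0 -> g i != 0.
  by rewrite ffunE; apply: contra_neq => ->; rewrite meval0.
exact/esym/(coprime_proportional_degree fc fc' fh fh' prop (ne0 _ fi) (ne0 _ fi')).
Qed.

End Degree.

Section DegreeSum.
Variables (k : closedFieldType) (p : nat) (E : finGroupScheme k).
Local Notation H := (measures E).
Local Notation R := (Rad H).
Local Notation n := (\dim R).
Hypothesis charkp : p \in [pchar k].
Hypothesis abE : abelian_scheme E.
Hypothesis nilp : forall u : H, u 1 = 0 -> u ^+ p = 0.
Variables (M : eModule E) (j : nat).
Hypothesis crM : constant_rank p M j.
Local Notation d := (max_rank p M j).
Local Notation M' := ('Hom(M, k^o)).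

Let HC : forall u v : H, u * v = v * u := meas_mulC abE.

Lemma predual_basis : exists vs : 'I_(\dim {:M'}) -> M,
  (forall l (phi : M'), coord (vbasis {:M'}) l phi = phi (vs l)) /\
  (forall v, exists c : 'I_(\dim {:M'}) -> k, v = \sum_l c l *: vs l).
Proof.
have /fin_all_exists[vs vsP] : forall l : 'I_(\dim {:M'}),
    exists v, forall phi, coord_form l phi = phi v.
  by move=> l; exact: reflexive.
have vsE l (phi : M') : coord (vbasis {:M'}) l phi = phi (vs l).
  by rewrite -vsP coord_formE.
exists vs; split=> // v; pose X := [tuple vs l | l < \dim {:M'}].
have XE (l : 'I_(\dim {:M'})) : X`_l = vs l by rewrite -tnth_nth tnth_mktuple.
suff vX : v \in <<X>>%VS.
  exists (fun l => coord X l v); rewrite {1}(coord_span vX).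
  by apply: eq_bigr => l _; rewrite XE.
apply/negPn/negP => /separating_form[F [FX]].
suff -> : F = 0 by rewrite zero_lfunE => /esym/eqP; rewrite oner_eq0.
rewrite [F](coord_vbasis (memvf F)) big1 // => l _.
by rewrite vsE -XE FX ?scale0r // memv_span // mem_nth // size_tuple.
Qed.

Variable vs : 'I_(\dim {:M'}) -> M.
Hypothesis vsE : forall l (phi : M'), coord (vbasis {:M'}) l phi = phi (vs l).
Hypothesis vs_span : forall v, exists c : 'I_(\dim {:M'}) -> k, v = \sum_l c l *: vs l.

Local Notation X := (op_pow_mx vs j).

Lemma minor_eval u (I : incr_map d (\dim {:M'})) (J : incr_map d (\dim {:M})) : u \in R ->
  (minor X I J).@[rcoord R u] =
  minor (\matrix_(l, i) coord (vbasis {:M}) i (op_pow M u j (vs l))) I J.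
Proof.
move=> uR; rewrite -[LHS](minor_map (meval (rcoord R u))).
by rewrite -[X in op_pow M X](rcoordK uR) -op_pow_mx_eval.
Qed.

Lemma minor_rows u : u \in R -> u \notin (R ^+ 2)%VS ->
  exists lam : incr_map d (\dim {:M'}) -> k,
    [/\ forall I J, (minor X I J).@[rcoord R u]
          = lam I * wedge (fun a : 'I_d => (vbasis (limg (op_pow M u j)))`_a) J,
        exists I, lam I != 0 &
        exists J, wedge (fun a : 'I_d => (vbasis (limg (op_pow M u j)))`_a) J != 0].
Proof.
move=> uR uR2; have dW := rank_const abE charkp nilp crM uR uR2.
have [|w /memv_imgP[v _ ->]|lam [lamE lam0 w0]] :=
    pluecker_minors (vs := fun l => op_pow M u j (vs l)) dW.
- by move=> l; rewrite memv_img ?memvf.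
- have [c ->] := vs_span v; exists c; rewrite linear_sum /=.
  by apply: eq_bigr => l _; rewrite linearZ.
by exists lam; split=> // I J; rewrite minor_eval // lamE.
Qed.

Lemma minor_columns u : u \in R -> u \notin (R ^+ 2)%VS ->
  let W := limg (op_pow (dual_module M) (meas_antipode u) j) in
  exists lam : incr_map d (\dim {:M}) -> k,
    [/\ forall I J, (minor X I J).@[rcoord R u]
          = lam J * wedge (M := M') (fun a : 'I_d => (vbasis W)`_a) I,
        exists J, lam J != 0 &
        exists I, wedge (M := M') (fun a : 'I_d => (vbasis W)`_a) I != 0].
Proof.
move=> uR uR2 W.
have dW : \dim (W : {vspace M'}) = d.
  by rewrite [LHS]dual_rank meas_antipodeK //; exact: rank_const.
pose T := op_pow (dual_module M) (meas_antipode u) j.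
have TE (phi : M') : T phi = (phi \o op_pow M u j)%VF.
  by rewrite /T dual_op_pow meas_antipodeK.
have [|w /memv_imgP[phi _ ->]|lam [lamE lam0 w0]] :=
    pluecker_minors (M := M') (vs := fun i => T (coord_form i)) dW.
- by move=> l; rewrite memv_img ?memvf.
- exists (fun i => (phi : M') (vbasis {:M})`_i).
  rewrite {1}(form_expand (phi : M')) linear_sum /=.
  by apply: eq_bigr => l _; rewrite linearZ.
exists lam; split=> // I J; rewrite minor_eval // -lamE -minor_tr; congr (minor _ J I).
by apply/matrixP => i l; rewrite !mxE vsE TE comp_lfunE coord_formE.
Qed.

Lemma degree_sum u0 v0 : u0 \in R -> v0 \in R ->
  (forall s t : k, (s, t) != (0, 0) -> s *: u0 + t *: v0 \notin (R ^+ 2)%VS) ->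
  (degree R (@U_E k E) (fun L => pluecker d (Im_map M j L))
   + degree R (@U_E k E) (fun L => pluecker d (Im_map (dual_module M) j L))
   = j * d)%N.
Proof.
move=> u0R v0R plane.
have uvR s t : s *: u0 + t *: v0 \in R by rewrite memvD ?memvZ.
have u0R2 : u0 \notin (R ^+ 2)%VS.
  by have := plane 1 0; rewrite xpair_eqE oner_eq0 scale1r scale0r addr0; apply.
pose N (I : incr_map d (\dim {:M'})) (J : incr_map d (\dim {:M})) := minor X I J.
have Nh I J : N I J \is (d * j).-homog.
  by apply: minor_homog => l i; exact: op_pow_mx_homog.
have N1 I J I' J' : N I J * N I' J' = N I J' * N I' J.
  apply: (Rad_dense u0R u0R2) => x xR2.
  have [lam [+ _ _]] := minor_rows (rvec_mem x) xR2.
  move: (wedge _) => w lamE; have NE K L : (N K L).@[x] = lam K * w L.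
    by rewrite -(meval_eq (N K L) (rvecK x)); exact: lamE.
  rewrite [LHS]mevalM [RHS]mevalM !NE.
  by rewrite mulrACA [w J * _]mulrC mulrACA.
have Nuv (s t : k) : (s, t) != (0, 0) ->
    exists I J, (N I J).@[fun l => s * rcoord R u0 l + t * rcoord R v0 l] != 0.
  move=> st0.
  have [lam [lamE [I lamI] [J wJ]]] := minor_rows (uvR s t) (plane s t st0).
  exists I, J; rewrite -(meval_eq _ (rcoordP s u0 t v0)) lamE.
  exact: mulf_neq0.
have [a [b [da [db [ac bc [ah bh] dE NE]]]]] := homog_rank1_factor Nh N1 Nuv.
have degM : has_degree R (@U_E k E) (fun L => pluecker d (Im_map M j L)) db.
  exists b; split=> // L /vpick_U_E[LR LR2].
  have [lam [lamE lam0 w0]] := minor_rows LR LR2.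
  apply: (line_eq (lam := lam) (a := fun I => (a I).@[rcoord R (vpick L)])) => // I J.
  by rewrite -lamE -[minor X I J]/(N I J) NE mevalM.
pose S := @meas_antipode k E.
have SR u : (S u \in R) = (u \in R) by rewrite !(mem_Rad HC nilp) antipode_augmentation.
have SR2 u : (S u \in (R ^+ 2)%VS) = (u \in (R ^+ 2)%VS) := antipode_Rad2 abE u nilp.
pose Sform (l : 'I_n) : 'Hom(H, k^o) := linfun (fun u : H => rcoord R (S u) l : k^o).
have SformE l u : Sform l u = rcoord R (S u) l.
  by rewrite linfunE // => c x y; rewrite /S meas_antipode_linear /rcoord linearP.
pose lq := [tuple form_poly R (Sform l) | l < n].
have lqE x l : (tnth lq l).@[x] = rcoord R (S (rvec x)) l.
  by rewrite tnth_mktuple form_polyE SformE.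
have lqK x l : (tnth lq l).@[fun l' => (tnth lq l').@[x]] = x l.
  rewrite lqE -[RHS](rvecK x l); congr (rcoord R _ l).
  rewrite -[RHS]meas_antipodeK //; congr (meas_antipode _).
  have SxR : S (rvec x) \in R by rewrite SR rvec_mem.
  rewrite -[RHS](rcoordK SxR); apply: eq_bigr => l' _.
  by rewrite lqE.
have degM' : has_degree R (@U_E k E)
    (fun L => pluecker (M := M') d (Im_map (dual_module M) j L)) da.
  exists (fun I => a I \mPo lq); split=> [I||L /vpick_U_E[LR LR2]].
  - by apply: homog_comp_linear => // l; rewrite tnth_mktuple form_poly_homog.
  - exact: coprime_comp.
  have SLR : S (vpick L) \in R by rewrite SR.
  have SLR2 : S (vpick L) \notin (R ^+ 2)%VS by rewrite SR2.
  have := minor_columns SLR SLR2; rewrite /S meas_antipodeK // => -[lam [lamE lam0 w0]].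
  apply: (line_eq (lam := lam)
    (a := fun J => (b J).@[rcoord R (meas_antipode (vpick L))])) => // J I.
  rewrite -lamE -[minor X I J]/(N I J) NE mevalM mulrC comp_mpoly_meval; congr (_ * _).
  by apply: meval_eq => l; rewrite lqE rcoordK.
rewrite (degree_unique u0R u0R2 degM) => [|L /vpick_U_E[LR LR2]]; last first.
  have [lam [_ _ [J wJ]]] := minor_rows LR LR2.
  rewrite -subv0 -memvE memv0; apply: contraNneq wJ => ->.
  by rewrite ffunE.
rewrite (degree_unique u0R u0R2 degM') => [|L /vpick_U_E[LR LR2]]; last first.
  have SLR : S (vpick L) \in R by rewrite SR.
  have SLR2 : S (vpick L) \notin (R ^+ 2)%VS by rewrite SR2.
  have := minor_columns SLR SLR2; rewrite /S meas_antipodeK // => -[lam [_ _ [J wJ]]].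
  rewrite -subv0 -memvE memv0; apply: contraNneq wJ => ->.
  by rewrite ffunE.
by rewrite addnC dE mulnC.
Qed.

End DegreeSum.

Unset Implicit Arguments.

Theorem theorem6p2p5 (k : closedFieldType) (p : nat) (charkp : p \in [pchar k])
    (E : finGroupScheme k) (elemE : elementary_abelian p E)
    (not_rank1 : (\dim (Rad (measures E)) - \dim (Rad (measures E) ^+ 2))%N
                 <> 1%N)
    (j : nat) (j_bounds : (1 <= j <= p - 1)%N)
    (M : eModule E) (crM : constant_rank p M j) :
  (mod_degree p M j + mod_degree p (dual_module M) j = j * max_rank p M j)%N.
Proof.
have abE : abelian_scheme E by case: elemE.
have nilp := elementary_nilp charkp elemE.
rewrite /mod_degree dual_max_rank //.
have [->|d0] := eqVneq (max_rank p M j) 0%N; first by rewrite muln0.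
have j_gt0 : (0 < j)%N by case/andP: j_bounds.
have d_gt0 : (0 < max_rank p M j)%N by rewrite lt0n.
have [u [v [uR vR plane]]] := Rad_plane abE charkp nilp j_gt0 crM d_gt0 not_rank1.
have [vs [vsE vs_span]] := predual_basis M.
exact: (degree_sum charkp abE nilp crM vsE vs_span uR vR plane).
Qed.
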